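(* Let $\mu$ be a probability measure on $\mathbb{R}$ and $\mu^n$ its $n$-fold product on $\mathbb{R}^n$. (i) If $\mathcal{C}_1(\mu,\alpha,2)<\infty$ for some $0<\alpha<1$, then for any $f:\mathbb{R}^n\to\mathbb{R}$ that is $1$-Lipschitz with respect to $d_p$ with $1<p\le\infty$, $$\operatorname{Var}_{\mu^n}(f)\le\mathcal{C}_1(\mu,\alpha,2)\cdot n^{1-\frac{\alpha(p-1)}{p}}\cdot\left(\sum_{i=1}^n\mathbb{E}_{\mu^n}\left[|d_if|^{\frac{p}{p-1}}\right]\right)^{\frac{\alpha(p-1)}{p}}=O\left(n^{\frac{p-\alpha(p-1)}{p}}\right).$$ (ii) If $\mathcal{C}_2(\mu,\alpha)<\infty$ for some $0<\alpha<1$, then for any $f:\mathbb{R}^n\to\mathbb{R}$ that is $1$-Lipschitz with respect to $d_p$ with $1<p\le2$, $$\operatorname{Var}_{\mu^n}(f)\le\mathcal{C}_2(\mu,\alpha)\cdot n^{1-\frac{2\alpha(p-1)}{p}}\cdot\left(\sum_{i=1}^n\mathbb{E}_{\mu^n}\left[|d_if|^{\frac{p}{p-1}}\right]\right)^{\frac{2\alpha(p-1)}{p}}=O\left(n^{\frac{p-2\alpha(p-1)}{p}}\right).$$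
   Context: For $x,y\in\mathbb{R}^n$, $d_p(x,y)=(\sum_{i=1}^n|x_i-y_i|^p)^{1/p}$ (maximum of $|x_i-y_i|$ if $p=\infty$). $f$ is $1$-Lipschitz with respect to $d_p$ if $|f(x)-f(y)|\le d_p(x,y)$ for all $x,y$. When $p=\infty$, set $\frac{p}{p-1}=1$, $\frac{p-1}{p}=1$ (so $\frac{p-\alpha(p-1)}{p}=1-\alpha$). The $i$th derivative is $d_if(x)=\limsup_{\epsilon\to0}\frac{f(x_1,\dots,x_i+\epsilon,\dots,x_n)-f(x_1,\dots,x_n)}{\epsilon}$. For a probability measure $\mu$ on $\mathbb{R}$, the median is $m_\mu(g)=\inf\{x: \mathbb{P}_\mu(g\le x)\ge\frac12\}$, $|\nabla g(x)|=\limsup_{y\to x}\frac{|g(x)-g(y)|}{|x-y|}$, $\operatorname{Lip}_1(\mathbb{R})$ is the set of $1$-Lipschitz functions on $\mathbb{R}$, and for $0<\alpha\le1$, $\beta\ge1$, $$\mathcal{C}_1(\mu,\alpha,\beta)=\sup_{g\in\operatorname{Lip}_1(\mathbb{R})}\frac{\mathbb{E}_\mu[|g-m_\mu(g)|^\beta]}{(\mathbb{E}_\mu[|\nabla g|])^\alpha},\qquad\mathcal{C}_2(\mu,\alpha)=\sup_{g\in\operatorname{Lip}_1(\mathbb{R})}\frac{\mathbb{E}_\mu[|g-m_\mu(g)|^2]}{(\mathbb{E}_\mu[|\nabla g|^2])^\alpha},$$ where a ratio $0/0$ is read as $0$ and $c/0$ with $c>0$ as $+\infty$. The $O(\cdot)$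 is as $n\to\infty$ with $\mu,\alpha,p$ fixed, uniformly over $f$.
   Formalization: The last equality, that the middle expression is O(·), is claimed only for f differentiable μ^n-almost everywhere, because it fails for some 1-Lipschitz f when μ has atoms; the first inequality and Var(f)=O(·) are claimed for all f. *)

(* Defs.v *)
From HB Require Import structures.
From mathcomp Require Import all_boot all_order all_algebra.
From mathcomp Require Import all_classical all_reals all_analysis.

Set Implicit Arguments.
Unset Strict Implicit.
Unset Printing Implicit Defensive.

Import Order.TTheory GRing.Theory Num.Theory.
Import numFieldNormedType.Exports.

Local Open Scope classical_set_scope.
Local Open Scope ring_scope.

Section power_probability.
Context d (T : measurableType d) (R : realType).

Definition cons_pair n (xt : T * n.-tuple T) : n.+1.-tuple T :=
  [tuple of xt.1 :: xt.2].

Lemma measurable_cons_pair n : measurable_fun [set: T * n.-tuple T] (@cons_pair n).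
Proof. exact: (measurable_cons measurable_fst measurable_snd). Qed.

HB.instance Definition _ n :=
  isMeasurableFun.Build _ _ _ _ (@cons_pair n) (@measurable_cons_pair n).

Fixpoint power_probability (mu : probability T R) n :
    probability (n.-tuple T) R :=
  match n with
  | 0 => dirac [tuple]
  | m.+1 => distribution (mu \x power_probability mu m)%E (@cons_pair m)
  end.

Lemma power_probability_box (mu : probability T R) n (A : 'I_n -> set T) :
  (forall i, measurable (A i)) ->
  power_probability mu n [set x | forall i, A i (tnth x i)] =
  (\prod_(i < n) mu (A i))%E.
Proof.
elim: n A => [|n IH] A mA /=.
  rewrite big_ord0 diracE mem_set//; by case.
rewrite big_ord_recl /distribution /pushforward.
rewrite -(IH (fun i => A (lift ord0 i)))//.
rewrite -product_measure1E//; last first.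
  suff -> : [set x : n.-tuple T | forall i, A (lift ord0 i) (tnth x i)] =
      \bigcap_(i in [set: 'I_n]) (@tnth n T ^~ i @^-1` A (lift ord0 i)).
    apply: fin_bigcap_measurable => // i _.
    by rewrite -[X in measurable X]setTI; exact: measurable_tnth.
  by apply/seteqP; split=> x /= h i; [move=> _|]; exact: h.
congr ((mu \x _)%E _); apply/seteqP; split=> -[x t] /= h.
  split; first by move: (h ord0); rewrite tnth0.
  by move=> i; move: (h (lift ord0 i)); rewrite tnthS.
case: h => h0 h i; case: (unliftP ord0 i) => [j ->|->].
  by rewrite tnthS; exact: h.
by rewrite tnth0.
Qed.

End power_probability.

Section one_dimensional.
Context (R : realType).
Implicit Types (mu : probability R R) (g : R -> R).

Definition Lip1 : set (R -> R) :=
  [set g | forall x y, `|g x - g y| <= `|x - y|].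

Definition median mu g : R :=
  inf [set x | (2^-1%:E <= mu [set t | (g t <= x)%R])%E].

Definition abs_grad g (x : R) : \bar R :=
  lime_sup (fun y => (`|g x - g y| / `|x - y|)%:E) x.

(* In [\bar R] the inverse of 0 is +oo and 0 * +oo = 0, so that the quotients
   below satisfy 0 / 0 = 0 and c / 0 = +oo for c > 0. *)
Definition C1 mu (alpha beta : R) : \bar R :=
  ereal_sup [set ((\int[mu]_x (`|g x - median mu g| `^ beta)%:E) /
                  (\int[mu]_x abs_grad g x) `^ alpha)%E | g in Lip1].

Definition C2 mu (alpha : R) : \bar R :=
  ereal_sup [set ((\int[mu]_x (`|g x - median mu g| ^+ 2)%:E) /
                  (\int[mu]_x (abs_grad g x) ^+ 2) `^ alpha)%E | g in Lip1].

End one_dimensional.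

Section n_dimensional.
Context (R : realType).
Implicit Types (p : \bar R) (n : nat).

(* [conj_exp p] is p / (p - 1) and [conj_inv p] is (p - 1) / p, both read as 1
   at p = +oo; their value at -oo is irrelevant. *)
Definition conj_exp p : R := if p is r%:E then r / (r - 1) else 1.

Definition conj_inv p : R := if p is r%:E then (r - 1) / r else 1.

Definition dist_p p n (x y : n.-tuple R) : R :=
  if p is r%:E then (\sum_(i < n) `|tnth x i - tnth y i| `^ r) `^ r^-1
  else \big[Num.max/0]_(i < n) `|tnth x i - tnth y i|.

Definition lipschitz_p p n (f : n.-tuple R -> R) : Prop :=
  forall x y, `|f x - f y| <= dist_p p x y.

Definition shift_coord n (x : n.-tuple R) (i : 'I_n) (e : R) : n.-tuple R :=
  [tuple if j == i then tnth x j + e else tnth x j | j < n].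

Definition partial_sup n (f : n.-tuple R -> R) (i : 'I_n) (x : n.-tuple R) :
    \bar R :=
  lime_sup (fun e => ((f (shift_coord x i e) - f x) / e)%:E) 0.

Definition sum_partials (mu : probability R R) p n (f : n.-tuple R -> R) :
    \bar R :=
  (\sum_(i < n)
     \int[power_probability mu n]_x `|partial_sup f i x| `^ conj_exp p)%E.

(* Where an f that is 1-Lipschitz for dist_p is differentiable, the sum of its
   |d_i f| ^ (p / (p - 1)) is at most 1.  If mu has atoms, f may fail to be
   differentiable on a set of positive measure, and there the sum may be n.
   Differentiability is a notion of normed modules, hence the passage from
   tuples, which carry the product sigma-algebra, to row vectors. *)
Definition differentiable_tuple n (f : n.-tuple R -> R) (x : n.-tuple R) :
    Prop :=
  differentiable (fun v : 'rV[R]_n => f [tuple v 0 i | i < n])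
                 (\row_i tnth x i).

End n_dimensional.

(* Main.v *)
Require Import Defs.
From HB Require Import structures.
From mathcomp Require Import all_boot all_order all_algebra.
From mathcomp Require Import all_classical all_reals all_analysis.
From mathcomp Require Import measurable_realfun ring lra.

(** In dimension one, a 1-Lipschitz g satisfies
    [Var g <= C (E |d g|^k)^alpha] with the signed derivative [d g] in place of
    the full gradient: g is the primitive of its derivative (Radon-Nikodym and
    Lebesgue differentiation), and deleting the part of the derivative carried
    by a small open set containing the Lebesgue-null support of the singular
    part of mu changes g uniformly little, so that only points of
    differentiability of g matter.  The Efron-Stein inequality and Jensen's
    inequality for [y |-> y^alpha] yield
    [Var f <= C sum_i (E |d_i f|^k)^alpha], and Hoelder's inequality turns this
    into the stated bound, with k = 1 in (i) and k = 2 in (ii).  At a point of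
    differentiability the partial derivatives of f have dual norm at most 1, so
    the sum of the [E |d_i f|^(p/(p-1))] is at most 1 there; for a general f one
    first averages f over a small cube, which makes it differentiable
    everywhere without affecting its Lipschitz constant. *)

Import Order.TTheory GRing.Theory Num.Theory.
Import numFieldNormedType.Exports.

Set Implicit Arguments.
Unset Strict Implicit.
Unset Printing Implicit Defensive.

Local Open Scope classical_set_scope.
Local Open Scope ring_scope.

(** * Upper limits at the origin *)

(** The signed quotients behind [dsup] and [partial_sup] can hide a slope: for g(x) = -max(x, 0)
    their upper limit at the origin is 0, while the full gradient there is 1. If [mu] charges such a
    point, an inequality in terms of the full gradient does not directly give one in terms of
    [dsup]. What helps is that uniformly small changes of g hardly affect its variance but can
    change its gradient completely, so it is enough to have good gradients arbitrarily near g; the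
    smoothing in n variables rests on the same principle.

    Both parts are one argument with a parameter k. With q = p/(p-1), the exponent theta = alpha k/q
    comes from bounding (E |d_i f|^k)^alpha by (E |d_i f|^q)^theta, which needs k <= q; for k = 2
    this says p <= 2. The median may be forgotten: the mean minimises the second moment, so any
    centre [m] serves. Finiteness of the second moment of [mu] comes from testing the functional on
    the identity. *)

Section limsup_at_zero.
Context {R : realType}.
Implicit Types (phi psi : R -> R).

(** Difference quotients of 1-Lipschitz functions are bounded by 1, so their upper limits are finite
    and [fine] loses nothing. *)
Definition limsup0 phi : R := fine (lime_sup (EFin \o phi) 0).

Lemma limsup0_itv phi c : (forall e, `|phi e| <= c) ->
  ((- c)%:E <= lime_sup (EFin \o phi) 0 <= c%:E)%E.
Proof.
move=> phic; rewrite lime_supE; apply/andP; split.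
  apply: le_ereal_inf_tmp => _ [e /= + <-]; rewrite in_itv/= andbT => e0.
  apply: (@le_trans _ _ (phi (e / 2))%:E).
    by rewrite lee_fin; have := phic (e / 2); rewrite ler_norml => /andP[].
  apply: ereal_sup_ubound => /=; exists (e / 2) => //; split.
    by rewrite /ball/= sub0r normrN gtr0_norm ?divr_gt0// ltr_pdivrMr// ltr_pMr//
        ltrDl.
  by apply/eqP; rewrite gt_eqF// divr_gt0.
apply: ge_ereal_inf.
exists (ereal_sup [set (EFin \o phi) x | x in ball 0 1 `\ 0]).
  by exists 1 => //=; rewrite in_itv/= andbT ltr01.
apply: ge_ereal_sup => _ [e _ <-] /=.
by rewrite lee_fin (le_trans (ler_norm _)).
Qed.

Lemma limsup0K phi c : (forall e, `|phi e| <= c) ->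
  lime_sup (EFin \o phi) 0 = (limsup0 phi)%:E.
Proof.
move=> /limsup0_itv /andP[h1 h2]; rewrite /limsup0 fineK// fin_numE.
by apply/andP; split; apply/eqP => h; move: h1 h2; rewrite h.
Qed.

Lemma norm_limsup0_le phi c : (forall e, `|phi e| <= c) -> `|limsup0 phi| <= c.
Proof.
move=> phic; have := limsup0_itv phic; rewrite (limsup0K phic) !lee_fin.
by rewrite ler_norml.
Qed.

Lemma lime_sup_cvg (h : R -> R) a l : h x @[x --> a^'] --> l ->
  lime_sup (EFin \o h) a = l%:E.
Proof.
move=> /cvgrPdist_lt hl; rewrite lime_supE.
have hd (e : R) : 0 < e -> exists2 d, 0 < d &
    forall x, (ball a d `\ a) x -> `|l - h x| < e.
  move=> e0; have [d /= d0 hd] := hl e e0.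
  by exists d => // x [adx /eqP xa]; apply: hd => //=.
apply/eqP; rewrite eq_le; apply/andP; split; apply/lee_addgt0Pr => e e0.
  have [d d0 {}hd] := hd e e0.
  apply: ge_ereal_inf.
  exists (ereal_sup [set (EFin \o h) x | x in ball a d `\ a]).
    by exists d => //=; rewrite in_itv/= andbT.
  apply: ge_ereal_sup => _ [x /hd lx <-] /=; rewrite -EFinD lee_fin.
  by move: lx; rewrite ltr_norml => /andP[]; lra.
rewrite -leeBlDr//; apply: le_ereal_inf_tmp => _ [r /= + <-].
rewrite in_itv/= andbT => r0.
have [d d0 {}hd] := hd e e0.
pose x := a + Num.min r d / 2.
have m0 : 0 < Num.min r d by rewrite lt_min r0.
have [mr md] : Num.min r d <= r /\ Num.min r d <= d by rewrite !ge_min !lexx orbT.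
have bx s : Num.min r d <= s -> (ball a s `\ a) x.
  move=> ms; split; last by apply/eqP; rewrite /x; lra.
  by rewrite /ball/= /x opprD addrA subrr sub0r normrN gtr0_norm; lra.
apply: (@le_trans _ _ (h x)%:E); last first.
  by apply: ereal_sup_ubound; exists x => //; exact: bx.
rewrite -EFinB lee_fin.
by have := hd _ (bx _ md); rewrite ltr_norml => /andP[]; lra.
Qed.

Lemma limsup0_cvg phi l : phi e @[e --> 0^'] --> l -> limsup0 phi = l.
Proof. by move=> h; rewrite /limsup0 (lime_sup_cvg h). Qed.

Lemma limsup0_eq phi psi : (forall e, e != 0 -> phi e = psi e) ->
  limsup0 phi = limsup0 psi.
Proof.
move=> h; rewrite /limsup0 !lime_supE; congr (fine (ereal_inf _)).
apply: eq_imagel => e _; congr ereal_sup; apply: eq_imagel => x [_ /eqP/h /=].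
by move=> ->.
Qed.

(** By continuity away from 0, the supremum over a punctured ball may be taken over its rationals,
    and radii 1/(n+1) suffice; the upper limit becomes a countable infimum of countable suprema. *)
Lemma measurable_limsup0 d (T : measurableType d) (phi : T -> R -> R) c :
  (forall x e, `|phi x e| <= c) ->
  (forall e, e != 0 -> measurable_fun setT (phi ^~ e)) ->
  (forall x e, e != 0 -> {for e, continuous (phi x)}) ->
  measurable_fun setT (fun x => limsup0 (phi x)).
Proof.
move=> phic mphi cphi.
pose r k : R := if unpickle k is Some q then ratr q else 0.
(* Indices outside the punctured ball get the value [- c], a lower bound of [phi x], which cannot
   raise the supremum. *)
pose u n k x : R := if (r k != 0) && (`|r k| < n.+1%:R^-1) then phi x (r k) else - c.
suff E x : lime_sup (EFin \o phi x) 0 =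
    ereal_inf (range (fun n => ereal_sup (range (fun k => (u n k x)%:E)))).
  apply: (measurableT_comp (fine_measurable measurableT)).
  rewrite (funext E); have -> : (fun x => ereal_inf (range (fun n =>
     ereal_sup (range (fun k => (u n k x)%:E))))) = (fun x => einfs (fun n =>
     esups (fun k => (u n k x)%:E) 0) 0).
    apply/funext => x; rewrite /einfs /esups; congr ereal_inf.
    have sE (v : nat -> \bar R) : sdrop v 0 = range v.
      by rewrite /sdrop; apply/seteqP; split => y /= [k hk vk]; exists k.
    by rewrite sE; apply: eq_imagel => n _; rewrite /= sE.
  apply: measurable_fun_einfs => n; apply: measurable_fun_esups => k.
  apply/measurable_EFinP; rewrite /u; case: (boolP (_ && _)) => [/andP[rk _]|_].
    exact: mphi.
  exact: measurable_cst.
rewrite lime_supE; apply/eqP; rewrite eq_le; apply/andP; split.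
  apply: le_ereal_inf_tmp => _ [n _ <-]; apply: ge_ereal_inf.
  exists (ereal_sup [set (EFin \o phi x) e | e in ball 0 n.+1%:R^-1 `\ 0]).
    by exists n.+1%:R^-1 => //=; rewrite in_itv/= andbT.
  apply: ge_ereal_sup => _ [e [be /eqP e0] <-] /=.
  apply/lee_addgt0Pr => eps eps0; rewrite -leeBlDr//.
  have /cvgrPdist_lt /(_ _ eps0) := cphi x e e0.
  rewrite near_nbhs/= => -[dlt /= dlt0 hd].
  have be1 : `|e| < n.+1%:R^-1 by move: be; rewrite /ball/= sub0r normrN.
  (* A rational closer than [del] to [e] is nonzero, stays in the ball and gives nearly the same
     value. *)
  pose del := Num.min dlt (Num.min `|e| (n.+1%:R^-1 - `|e|)).
  have del0 : 0 < del by rewrite !lt_min dlt0 normr_gt0 e0 subr_gt0.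
  have [q] := @rat_in_itvoo R (e - del) (e + del) ltac:(lra).
  rewrite in_itv/= => /andP[q1 q2].
  have eq1 : `|e - ratr q| < del by rewrite ltr_norml; apply/andP; split; lra.
  have /and3P[d1 d2 d3]: [&& del <= dlt, del <= `|e| & del <= n.+1%:R^-1 - `|e|].
    by rewrite -!le_min.
  have rq : r (pickle q) = ratr q by rewrite /r pickleK.
  have rq0 : ratr q != 0 :> R.
    by apply/eqP => q0; move: eq1; rewrite q0 subr0; lra.
  have rqn : `|ratr q : R| < n.+1%:R^-1.
    have : `|ratr q : R| <= `|e| + `|e - ratr q|.
      by rewrite -{1}(subKr e (ratr q)) ler_normB.
    by move/le_lt_trans; apply; rewrite -ltrBrDl (lt_le_trans eq1 d3).
  apply: (@le_trans _ _ (phi x (ratr q))%:E).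
    rewrite -EFinB lee_fin.
    have : ball e dlt (ratr q) by rewrite /ball/=; lra.
    by move/hd; rewrite ltr_norml => /andP[_]/=; lra.
  apply: ereal_sup_ubound; exists (pickle q) => //.
  by rewrite /u rq rq0 rqn.
apply: le_ereal_inf_tmp => _ [e /= + <-]; rewrite in_itv/= andbT => e0.
have [n ne] : exists n, n.+1%:R^-1 <= e.
  exists (Num.truncn e^-1); rewrite -[leRHS]invrK lef_pV2 ?posrE ?invr_gt0//.
  by apply/ltW/truncnS_gt.
apply: ge_ereal_inf; exists (ereal_sup (range (fun k => (u n k x)%:E))) => //.
apply: ge_ereal_sup => _ [k _ <-]; rewrite /u; case: ifPn => [/andP[rk0 rkn]|_].
  apply: ereal_sup_ubound; exists (r k) => //; split; last exact/eqP.
  by rewrite /ball/= sub0r normrN (lt_le_trans rkn).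
apply: (@le_trans _ _ (phi x (e / 2))%:E).
  by rewrite lee_fin; have := phic x (e / 2); rewrite ler_norml => /andP[].
apply: ereal_sup_ubound; exists (e / 2) => //; split; last by move=> /eqP; lra.
by rewrite /ball/= sub0r normrN gtr0_norm; lra.
Qed.

End limsup_at_zero.

(** * Lipschitz functions of one variable *)

Section lipschitz_density.
Context {R : realType}.
Notation lambda := (@lebesgue_measure R).

(** A cover by half-open intervals of small total length is also a cover of small total [G]-length,
    larger by at most the factor [c]; this compares the two outer measures. *)
Lemma lebesgue_stieltjes_dominates (G : cumulative R R) (c : R) :
  (forall x y, x <= y -> G y - G x <= c * (y - x)) ->
  lebesgue_stieltjes_measure G `<< lambda.
Proof.
move=> Gc; apply/null_content_dominatesP => A mA lA0.
have c0 : 0 <= c.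
  have := Gc 0 1 ler01; rewrite subr0 mulr1; apply: le_trans.
  by rewrite subr_ge0 cumulative_is_nondecreasing.
have wle I : ocitv I -> (wlength G I <= c%:E * wlength (@idfun R) I)%E.
  move=> /ocitvP[->|[[a b] /= ab ->]]; first by rewrite !wlength0 mule0.
  by rewrite !wlength_itv_bnd ?(ltW ab)// -EFinM lee_fin Gc// ltW.
apply/eqP; rewrite eq_le measure_ge0 andbT.
apply/lee_addgt0Pr => e e0; rewrite add0e.
(* The added 1 covers the case [c = 0], and still [c * e' <= e]. *)
pose e' := e / (c + 1).
have e'0 : 0 < e' by rewrite divr_gt0// ltr_wpDl.
have : (lambda A < e'%:E)%E by rewrite lA0 lte_fin.
move=> /ereal_inf_lt [_ [F [mF AF] <-]] Fe.
have : (lebesgue_stieltjes_measure G A <= \sum_(k <oo) wlength G (F k))%E.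
  by apply: ereal_inf_lbound; exists F.
move=> /le_trans; apply.
apply: (@le_trans _ _ (\sum_(k <oo) (c%:E * wlength (@idfun R) (F k)))%E).
  apply: lee_nneseries => [k _ _|k _]; first exact: wlength_ge0.
  by apply: wle; exact: mF.
rewrite nneseriesZl//.
apply: (@le_trans _ _ (c%:E * e'%:E)%E).
  by apply: lee_wpmul2l; [rewrite lee_fin|exact: ltW].
rewrite -EFinM lee_fin /e' mulrCA ler_piMr ?(ltW e0)//.
by rewrite ler_pdivrMr ?ltr_wpDl// mul1r lerDl.
Qed.

Lemma lipschitz_continuous (g : R -> R) : Lip1 g -> continuous g.
Proof.
move=> gL x; apply/cvgrPdist_lt => e e0.
exists e => // y /= xy; exact: le_lt_trans (gL _ _) xy.
Qed.

Lemma lipschitz_measurable (g : R -> R) : Lip1 g -> measurable_fun setT g.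
Proof. by move=> /lipschitz_continuous; exact: continuous_measurable_fun. Qed.

(** Adding the identity makes g nondecreasing, with increments at most twice the length. The
    resulting Stieltjes measure is absolutely continuous, and the density of g is its Radon-Nikodym
    derivative minus 1. Restricting to []- M, M]] keeps the measure finite and the density
    integrable. *)
Lemma lipschitz_local_density (g : R -> R) (M : R) : Lip1 g -> 0 < M ->
  exists f : R -> R, lambda.-integrable setT (EFin \o f) /\
    forall a b, - M <= a -> a <= b -> b <= M ->
      g b - g a = \int[lambda]_(x in `]a, b]) f x.
Proof.
move=> gL M0.
have gB x y : x <= y -> `|g y - g x| <= y - x.
  by move=> xy; rewrite (le_trans (gL _ _))// ger0_norm// subr_ge0.
pose G x := g x + x.
have ndG : nondecreasing G.
  move=> x y xy; rewrite /G.
  by have := gB _ _ xy; rewrite ler_norml => /andP[]; lra.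
have rcG : right_continuous G.
  apply: right_continuousW => x; apply: cvgD; first exact: lipschitz_continuous.
  exact: cvg_id.
pose Gc : cumulative R R := HB.pack G (isCumulative.Build R _ R G ndG rcG).
pose nu := lebesgue_stieltjes_measure Gc.
have nuE (a b : R) : a <= b -> nu `]a, b]%classic = (G b - G a)%:E.
  move=> ab; transitivity (wlength Gc `]a, b]%classic); last by rewrite
      wlength_itv_bnd.
  rewrite /nu /lebesgue_stieltjes_measure /measure_extension.
  by apply: measurable_mu_extE; exact: is_ocitv.
have nudom : nu `<< lambda.
  apply: (@lebesgue_stieltjes_dominates _ 2) => x y xy.
  by rewrite /= /G; have := gB _ _ xy; rewrite ler_norml => /andP[]; lra.
pose D : set (measurableTypeR R) := `]- M, M]%classic.
have mD : measurable D by exact: measurable_itv.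
have nuoo : (nu D < +oo)%E by rewrite nuE ?ltry//; lra.
pose nuM : {finite_measure set (measurableTypeR R) -> \bar R} := mfrestr mD nuoo.
have nuMdom : nuM `<< lambda.
  apply: null_dominates_trans nudom.
  apply/null_content_dominatesP => A mA nuA0.
  apply/eqP; rewrite eq_le measure_ge0 andbT -nuA0.
  by apply: le_measure; rewrite ?inE//; exact: measurableI.
have [f [f0 ffin intf fE]] := radon_nikodym_sigma_finite nuMdom.
have fineF : EFin \o (fine \o f) = f by apply/funext => x /=; rewrite fineK.
exists (fun x => fine (f x) - \1_D x); split.
  rewrite (_ : _ \o _ = f \- (EFin \o \1_D))%E; last first.
    by apply/funext => x /=; rewrite EFinB fineK.
  by apply: integrableB => //; exact: integrable_indic_itv.
move=> a b Ma ab bM.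
have sab : `]a, b]%classic `<=` `]- M, M]%classic.
  move=> x /=; rewrite !in_itv/= => /andP[ax xb]; apply/andP; split; lra.
rewrite RintegralB//=; last 2 first.
- by rewrite fineF; exact: integrableS intf.
- by apply: (integrableS measurableT) => //; exact: integrable_indic_itv.
rewrite (@eq_Rintegral _ _ _ _ _ (cst 1) (\1_ _)); last first.
  by move=> x /set_mem /sab xM; rewrite indicE mem_set.
rewrite Rintegral_cst//= mul1r lebesgue_measure_itv/= lte_fin.
rewrite /Rintegral (_ : (fun x => (fine (f x))%:E) = f)//.
have <- : nuM `]a, b]%classic = (\int[lambda]_(x in `]a, b]) f x)%E by exact: fE.
have -> : nuM `]a, b]%classic = (G b - G a)%:E.
  by rewrite -nuE//; change (nu (`]a, b]%classic `&` D) = nu `]a, b]%classic);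
      rewrite setIidl.
rewrite /G /=.
have [_|ba] := ltP a b; first by rewrite -EFinB/=; ring.
by rewrite /=; lra.
Qed.

End lipschitz_density.

Lemma ae_imply d (T : measurableType d) (R : realType)
  (m : {measure set T -> \bar R}) (P Q : T -> Prop) :
  (forall x, P x -> Q x) -> {ae m, forall x, P x} -> {ae m, forall x, Q x}.
Proof.
by move=> PQ; apply: filterS; exact: PQ.
Qed.

Lemma ae_imply2 d (T : measurableType d) (R : realType)
  (m : {measure set T -> \bar R}) (P Q S : T -> Prop) :
  (forall x, P x -> Q x -> S x) -> {ae m, forall x, P x} ->
  {ae m, forall x, Q x} -> {ae m, forall x, S x}.
Proof. by move=> PQS; apply: filterS2; exact: PQS. Qed.

Section lipschitz_differentiation.
Context {R : realType}.
Notation lambda := (@lebesgue_measure R).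
Implicit Types (g f F : R -> R).

Definition dquot g x e := (g (x + e) - g x) / e.

Definition dsup g x := limsup0 (dquot g x).

Lemma dquot_le1 g x e : Lip1 g -> `|dquot g x e| <= 1.
Proof.
move=> gL; have [->|e0] := eqVneq e 0; first by rewrite /dquot invr0 mulr0 normr0.
rewrite normrM normfV ler_pdivrMr ?normr_gt0// mul1r.
by rewrite (le_trans (gL _ _))// addrAC subrr add0r.
Qed.

Lemma norm_dsup_le1 g x : Lip1 g -> `|dsup g x| <= 1.
Proof. by move=> gL; apply: norm_limsup0_le => e; exact: dquot_le1. Qed.

Lemma measurable_dsup g : Lip1 g -> measurable_fun setT (dsup g).
Proof.
move=> gL; have cg := lipschitz_continuous gL.
apply: (@measurable_limsup0 _ _ _ (dquot g) 1).
- by move=> x e; exact: dquot_le1.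
- move=> e _; apply: continuous_measurable_fun => x.
  apply: cvgM; last exact: cvg_cst.
  apply: cvgB; last exact: cg.
  apply: continuous_comp; last exact: cg.
  by apply: cvgD; [exact: cvg_id|exact: cvg_cst].
- move=> x e e0; apply: cvgM; last exact: cvgV.
  apply: cvgB; last exact: cvg_cst.
  apply: continuous_comp; last exact: cg.
  by apply: cvgD; [exact: cvg_cst|exact: cvg_id].
Qed.

Lemma derivable_dquot F x l : derivable F x 1 -> derive1 F x = l ->
  dquot F x e @[e --> 0^'] --> l.
Proof.
rewrite /derivable => dF <-.
have E : (fun h : R => h^-1 *: (F (h + x) - F x)) = dquot F x.
  by apply/funext => h; rewrite /dquot [h + x]addrC mulrC.
rewrite /derive1 E; apply/cvg_ex; move: dF => /cvg_ex[k].
have -> : (fun h : R => h^-1 *: ((F \o shift x) (h *: 1) - F x)) = dquot F x.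
  by rewrite -E; apply/funext => h /=; rewrite [_ *: 1]mulr1.
by exists k.
Qed.

Lemma near_dquot_cvg g F x (l : R) :
  (\forall e \near (0 : R)^', dquot g x e = dquot F x e) ->
  dquot F x e @[e --> 0^'] --> l -> dquot g x e @[e --> 0^'] --> l.
Proof.
by move=> h; apply: cvg_trans; apply: near_eq_cvg; apply: filterS h => e ->.
Qed.

Lemma integral_ocitvB f a b : lambda.-integrable setT (EFin \o f) -> a <= b ->
  \int[lambda]_(t in `]-oo, b]) f t - \int[lambda]_(t in `]-oo, a]) f t =
  \int[lambda]_(t in `]a, b]) f t.
Proof.
move=> intf ab; apply: Rintegral_itvB => //.
by apply: (integrableS measurableT).
Qed.

Lemma ae_dquot_integral f : lambda.-integrable setT (EFin \o f) ->
  {ae lambda, forall x,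
    dquot (fun y => \int[lambda]_(t in `]-oo, y]) f t) x e @[e --> 0^'] --> f x}.
Proof.
move=> intf.
have /FTC1Ny : forall y, lambda.-integrable `]-oo, y] (EFin \o f).
  by move=> y; exact: (integrableS measurableT).
have lf : locally_integrable [set: R] f.
  by have := integrable_locally measurableT intf; rewrite patch_setT.
move=> /(_ lf); apply: ae_imply => x [d1 d2].
exact: derivable_dquot.
Qed.

Lemma lipschitz_ae_dquot g (M : R) f : lambda.-integrable setT (EFin \o f) ->
  (forall a b, - M <= a -> a <= b -> b <= M ->
      g b - g a = \int[lambda]_(x in `]a, b]) f x) ->
  {ae lambda, forall x, - M < x < M -> dquot g x e @[e --> 0^'] --> f x}.
Proof.
move=> intf gf; move: (ae_dquot_integral intf); apply: ae_imply => x + /andP[Mx xM].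
apply: near_dquot_cvg; near=> e.
rewrite /dquot; congr (_ / _).
have e1 : `|e| < x + M.
  by near: e; apply: dnbhs0_lt; lra.
have e2 : `|e| < M - x.
  by near: e; apply: dnbhs0_lt; lra.
move: e1 e2; rewrite !ltr_norml => /andP[e1 e2] /andP[e3 e4].
have [e0|e0] := leP 0 e.
  by rewrite integral_ocitvB//; [apply: gf|]; lra.
apply: oppr_inj; rewrite !opprB integral_ocitvB//; [apply: gf|]; lra.
Unshelve. all: by end_near. Qed.

Lemma ae_dsup g : Lip1 g ->
  {ae lambda, forall x, dquot g x e @[e --> 0^'] --> dsup g x}.
Proof.
move=> gL.
have /ae_foralln : forall n : nat, {ae lambda, forall x, - n.+1%:R < x < n.+1%:R ->
    exists l : R, dquot g x e @[e --> 0^'] --> l}.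
  move=> n; have [|f [intf gf]] := @lipschitz_local_density _ g n.+1%:R gL.
    by rewrite ltr0n.
  move: (lipschitz_ae_dquot intf gf); apply: ae_imply => x h xn.
  by exists (f x); exact: h.
apply: ae_imply => x h.
(* The windows ]-(n+1), n+1[ exhaust the line, and this index gives one that contains x. *)
have [|l gl] := h (Num.truncn `|x|).
  by rewrite -ltr_norml truncnS_gt.
by rewrite /dsup (limsup0_cvg gl).
Qed.

Lemma lipschitz_FTC g a b : Lip1 g -> a <= b ->
  g b - g a = \int[lambda]_(x in `]a, b]) dsup g x.
Proof.
move=> gL ab.
pose M := `|a| + `|b| + 1.
have aM : `|a| < M by rewrite /M; have := normr_ge0 b; lra.
have bM : `|b| < M by rewrite /M; have := normr_ge0 a; lra.
move: aM bM; rewrite !ltr_norml => /andP[a1 a2] /andP[b1 b2].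
have [|f [intf gf]] := @lipschitz_local_density _ g M gL; first by lra.
rewrite gf; [|lra..]; rewrite /Rintegral; congr fine.
apply: ae_eq_integral => //.
- apply: measurable_funS (measurable_int _ intf) => //.
- apply/measurable_EFinP; apply: measurable_funS (measurable_dsup gL) => //.
move: (lipschitz_ae_dquot intf gf); apply: ae_imply => x h.
rewrite /= in_itv/= => /andP[ax xb].
by rewrite /dsup (limsup0_cvg (h _))//; apply/andP; split; lra.
Qed.

End lipschitz_differentiation.

(** * Relaxation of the gradient *)

Section gradient_relaxation.
Context {R : realType}.
Notation lambda := (@lebesgue_measure R).
Implicit Types (g h : R -> R) (U N Z : set R).

(** Here the absolute value stands inside the upper limit, in |[dsup]| outside it. The two agree
    where the quotients converge. *)
Lemma abs_gradE h x : Lip1 h ->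
  abs_grad h x = (limsup0 (fun e => `|dquot h x e|))%:E.
Proof.
move=> hL; rewrite -(@limsup0K _ _ 1); last first.
  by move=> e; rewrite normr_id; exact: dquot_le1.
rewrite /abs_grad !lime_supE; congr ereal_inf; apply: eq_imagel => r _.
congr ereal_sup; apply/seteqP; split => _ [y [yr /eqP yx] <-] /=.
  exists (y - x); last first.
    by rewrite /dquot subrKC normrM normfV distrC -(distrC x).
  split; first by move: yr; rewrite /ball/= sub0r opprB.
  by apply/eqP; rewrite subr_eq0.
exists (x + y); last by rewrite /dquot normrM normfV distrC opprD addrA subrr sub0r
    normrN.
split; first by move: yr; rewrite /ball/= sub0r opprD addrA subrr sub0r.
by apply/eqP; rewrite -subr_eq0 addrAC subrr add0r.
Qed.

Lemma abs_grad_cvg h x l : Lip1 h -> dquot h x e @[e --> 0^'] --> l ->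
  abs_grad h x = `|l|%:E.
Proof. by move=> hL hl; rewrite abs_gradE// (limsup0_cvg (cvg_norm hl)). Qed.

Lemma abs_grad_ge0 h x : (0 <= abs_grad h x)%E.
Proof.
by apply: limf_esup_ge0 => // y; rewrite lee_fin divr_ge0.
Qed.

Lemma abs_grad_le1 h x : Lip1 h -> (abs_grad h x <= 1)%E.
Proof.
move=> hL; rewrite abs_gradE// lee_fin (le_trans (ler_norm _))//.
by apply: norm_limsup0_le => e; rewrite normr_id; exact: dquot_le1.
Qed.

Lemma measurable_abs_grad h : Lip1 h -> measurable_fun setT (abs_grad h).
Proof.
move=> hL.
have -> : abs_grad h = EFin \o (fun x => limsup0 (fun e => `|dquot h x e|)).
  by apply/funext => x; rewrite abs_gradE.
apply/measurable_EFinP; have ch := lipschitz_continuous hL.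
apply: (@measurable_limsup0 _ _ _ (fun x e => `|dquot h x e|) 1).
- by move=> x e; rewrite normr_id; exact: dquot_le1.
- move=> e _; apply: continuous_measurable_fun => x.
  apply: cvg_norm; apply: cvgM; last exact: cvg_cst.
  apply: cvgB; last exact: ch.
  apply: continuous_comp; last exact: ch.
  by apply: cvgD; [exact: cvg_id|exact: cvg_cst].
- move=> x e e0; apply: cvg_norm; apply: cvgM; last exact: cvgV.
  apply: cvgB; last exact: cvg_cst.
  apply: continuous_comp; last exact: ch.
  by apply: cvgD; [exact: cvg_cst|exact: cvg_id].
Qed.

(* Removing from g the part of its derivative carried by a small open set U
   makes it locally constant on U. *)
Lemma lipschitz_flatten g U (delta : R) : Lip1 g -> open U ->
  (lambda U <= delta%:E)%E ->
  exists h, [/\ Lip1 h, forall x, `|g x - h x| <= delta,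
    forall x, U x -> abs_grad h x = 0%E &
    {ae lambda, forall x, ~ U x -> abs_grad h x = `|dsup g x|%:E}].
Proof.
move=> gL oU Ud.
have mU : measurable U by exact: open_measurable.
(* As |f| is at most the indicator of U, its primitive [F] is bounded by the measure of U, hence by
   [delta]. The difference [h] of g and [F] is the primitive of a function that is [dsup g] off U
   and 0 on U, so it is still 1-Lipschitz. *)
pose f x := dsup g x * \1_U x.
have mf : measurable_fun setT f.
  by apply: measurable_funM; [exact: measurable_dsup|exact: measurable_indic].
have U0 x : 0 <= \1_U x :> R by rewrite indicE ler0n.
have fU x : `|f x| <= \1_U x.
  by rewrite normrM (ger0_norm (U0 x))// ler_piMl ?U0//; exact: norm_dsup_le1.
have intU : (\int[lambda]_x (\1_U x)%:E = lambda U)%E.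
  by rewrite integral_indic// setIT.
have iU : lambda.-integrable setT (EFin \o \1_U).
  apply/integrableP; split; first by apply/measurable_EFinP; exact: measurable_indic.
  under eq_integral do rewrite /= ger0_norm ?U0//.
  by rewrite intU (le_lt_trans Ud)// ltry.
have intf : lambda.-integrable setT (EFin \o f).
  apply: le_integrable iU => //; first exact/measurable_EFinP.
  by move=> x _; rewrite /= lee_fin [leRHS]ger0_norm ?U0.
pose F y := \int[lambda]_(t in `]-oo, y]) f t.
pose h x := g x - F x.
have iD a b : lambda.-integrable `]a, b] (EFin \o dsup g).
  apply: measurable_bounded_integrable => //.
  - by rewrite /= lebesgue_measure_itv/=; case: ifP => _; rewrite -?EFinB ltry.
  - exact: measurable_funS (measurable_dsup gL).
  - exists 1; split => // y y1 x _ /=.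
    by rewrite (le_trans (norm_dsup_le1 _ gL))// ltW.
have hE a b : a <= b -> h b - h a = \int[lambda]_(t in `]a, b]) (dsup g t - f t).
  move=> ab; rewrite RintegralB//; last exact: (integrableS measurableT).
  rewrite -lipschitz_FTC// -integral_ocitvB// /h /F; ring.
have hB a b : a <= b -> `|h b - h a| <= b - a.
  move=> ab; rewrite hE// (le_trans (le_normr_Rintegral _ _))//.
    apply: (@integrableB _ _ _ lambda `]a, b]%classic _ (EFin \o dsup g) (EFin \o
        f)) => //.
    exact: (integrableS measurableT).
  apply: (@le_trans _ _ (\int[lambda]_(t in `]a, b]) (cst 1 t))).
    apply: le_Rintegral => //.
    - apply: integrable_norm.
      apply: (@integrableB _ _ _ lambda `]a, b]%classic _ (EFin \o dsup g) (EFin \o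
          f)) => //.
      exact: (integrableS measurableT).
    - apply: measurable_bounded_integrable => //.
        by rewrite /= lebesgue_measure_itv/=; case: ifP => _; rewrite -?EFinB ltry.
      by exists 1; split => // y y1 x _ /=; rewrite normr1 ltW.
    - move=> x _ /=; rewrite /f -{1}(mulr1 (dsup g x)) -mulrBr normrM.
      rewrite mulr_ile1//; first exact: norm_dsup_le1.
      by rewrite indicE; case: (_ \in _); rewrite ?subrr ?subr0 ?normr0 ?normr1.
  rewrite Rintegral_cst//= mul1r lebesgue_measure_itv/= lte_fin.
  by case: ifP => _; rewrite -?EFinB//= subr_ge0.
have hL : Lip1 h.
  move=> x y; have [xy|/ltW xy] := leP x y.
    by rewrite distrC (distrC x) (le_trans (hB _ _ xy))// ler_norm.
  by rewrite (le_trans (hB _ _ xy))// ler_norm.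
exists h; split => //.
- move=> x; rewrite /h subKr /F.
  rewrite (le_trans (le_normr_Rintegral _ _))//; first exact: (integrableS
      measurableT).
  rewrite -lee_fin (le_trans _ Ud)// -intU /Rintegral fineK; last first.
    apply: integrable_fin_num => //; apply: integrable_norm.
    exact: (integrableS measurableT).
  apply: (@le_trans _ _ (\int[lambda]_(t in `]-oo, x]) (\1_U t)%:E)%E).
    apply: ge0_le_integral => //.
    - by apply/measurable_EFinP; apply: measurableT_comp => //; exact:
        measurable_funS mf.
    - by apply/measurable_EFinP; exact: measurable_indic.
    - by move=> t _; rewrite lee_fin.
  apply: ge0_subset_integral => //.
  by apply/measurable_EFinP; exact: measurable_indic.
- move=> x Ux.
  have /nbhs_ballP[d /= d0 dU] : nbhs x U by exact: open_nbhs_nbhs.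
  have -> : abs_grad h x = `|0 : R|%:E; last by rewrite normr0.
  apply: abs_grad_cvg => //; apply: (near_dquot_cvg (F := cst 0)); last first.
    rewrite (_ : dquot (cst 0) x = cst 0); first exact: cvg_cst.
    by apply/funext => e; rewrite /dquot subrr mul0r.
  (* On an interval inside U the integrand in [hE] is identically 0, so near any point of U the
     quotients of [h] vanish exactly. The conclusion thus holds at every point of U; an almost
     everywhere statement would say nothing about a Lebesgue-null set charged by [mu]. *)
  have flat a b : a <= b -> `]a, b] `<=` U -> h b - h a = 0.
    move=> ab abU; rewrite hE// (@eq_Rintegral _ _ _ _ _ (cst 0)).
      by rewrite Rintegral_cst// mul0r.
    by move=> t /set_mem/abU Ut; rewrite /f indicE mem_set// mulr1 subrr.
  near=> e; rewrite /dquot subrr mul0r.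
  have : `|e| < d by near: e; exact: dnbhs0_lt.
  rewrite ltr_norml => /andP[e1 e2].
  have [e0|e0] := leP 0 e.
    rewrite flat ?mul0r//; first by lra.
    move=> t /=; rewrite in_itv/= => /andP[t1 t2]; apply: dU.
    by rewrite /ball/= ltr_norml; apply/andP; split; lra.
  rewrite -opprB flat ?oppr0 ?mul0r//; first by lra.
  move=> t /=; rewrite in_itv/= => /andP[t1 t2]; apply: dU.
  by rewrite /ball/= ltr_norml; apply/andP; split; lra.
- apply: (ae_imply2 _ (ae_dquot_integral intf) (ae_dsup gL)) => x Ff gg nUx; have
    nU := memNset nUx; apply: abs_grad_cvg => //.
  rewrite (_ : dquot h x = dquot g x \- dquot F x); last first.
    by apply/funext => e; rewrite /dquot /h /=; ring.
  rewrite -[X in _ --> X](subr0 (dsup g x)); apply: cvgB => //.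
  by move: Ff; rewrite /f indicE nU mulr0.
Unshelve. all: by end_near. Qed.

(** Exhaustion: the supremum of [mu] over Lebesgue-null sets is attained by a countable union N of
    nearly optimal ones. A null set disjoint from N with positive mass would, joined to N, exceed
    the supremum. *)
Lemma singular_carrier (mu : probability R R) : exists N,
  [/\ measurable N, lambda N = 0%E &
      forall Z, measurable Z -> lambda Z = 0%E -> Z `&` N = set0 -> mu Z = 0%E].
Proof.
pose A := [set mu N | N in [set N | measurable N /\ lambda N = 0%E]].
pose s := ereal_sup A.
have s1 : (s <= 1)%E.
  by apply: ge_ereal_sup => _ [N [mN _] <-]; exact: probability_le1.
have s0 : (0 <= s)%E.
  apply: ereal_sup_ubound; exists set0; last by rewrite measure0.
  by split => //; rewrite measure0.
have sfin : s \is a fin_num.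
  by rewrite ge0_fin_numE// (le_lt_trans s1)// ltry.
have ex n : exists N, [/\ measurable N, lambda N = 0%E & (s - n.+1%:R^-1%:E <= mu
    N)%E].
  have n0 : 0 < (n.+1%:R^-1 : R) by rewrite invr_gt0.
  have [_ [N [mN N0] <-] hN] := ub_ereal_sup_adherent n0 sfin.
  by exists N; split => //; exact: ltW.
have [F /all_and3[mF F0 FS]] := choice ex.
have mN : measurable (\bigcup_n F n) by exact: bigcup_measurable.
have lN : lambda (\bigcup_n F n) = 0%E.
  apply: measure_negligible => //; apply: negligible_bigcup => k.
  by exists (F k); split => //; [exact: mF|exact: F0].
have sN : mu (\bigcup_n F n) = s.
  apply/eqP; rewrite eq_le; apply/andP; split.
    by apply: ereal_sup_ubound; exists (\bigcup_n F n).
  apply/lee_addgt0Pr => e e0.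
  pose n := Num.truncn e^-1.
  have ne : n.+1%:R^-1 <= e.
    rewrite -[leRHS]invrK lef_pV2 ?posrE ?invr_gt0//.
    by apply/ltW/truncnS_gt.
  rewrite -leeBlDr//; apply: le_trans (_ : (s - n.+1%:R^-1%:E <= _)%E).
    by rewrite leeB// lee_fin.
  apply: (le_trans (FS n)); apply: le_measure; rewrite ?inE//.
  exact: bigcup_sup.
exists (\bigcup_n F n); split => // Z mZ Z0 ZN.
have : (mu (Z `|` \bigcup_n F n) <= s)%E.
  apply: ereal_sup_ubound; exists (Z `|` \bigcup_n F n) => //.
  split; first exact: measurableU.
  transitivity (lambda Z + lambda (\bigcup_n F n))%E; first exact: measureU.
  by rewrite Z0 lN adde0.
have -> : mu (Z `|` \bigcup_n F n) = (mu Z + mu (\bigcup_n F n))%E by exact: measureU.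
rewrite sN -{2}(add0e s) leeD2rE// => Zle0.
by apply/eqP; rewrite eq_le Zle0 measure_ge0.
Qed.

(* The paper's one-dimensional functionals use the full gradient, whereas the
   theorem uses the signed upper derivative, which may be smaller in absolute
   value.  Both agree Lebesgue-a.e., and where mu is singular the gradient can
   be made to vanish. *)
Lemma abs_grad_relaxation (mu : probability R R) g (delta : R) :
  Lip1 g -> 0 < delta ->
  exists h, [/\ Lip1 h, forall x, `|g x - h x| <= delta &
    {ae mu, forall x, (abs_grad h x <= `|dsup g x|%:E)%E}].
Proof.
move=> gL d0.
have [N [mN N0 muN]] := singular_carrier mu.
have [U [oU NU]] := outer_measure_open_le N d0.
rewrite [X in (_ <= X + _)%E -> _]N0 add0e => Ud.
have [h [hL gh hU [Z [mZ Z0 hZ]]]] := lipschitz_flatten gL oU Ud.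
(* Points of N lie in U, where the gradient of [h] is 0. The remaining exceptional points form a
   Lebesgue-null set disjoint from N, which [mu] does not charge. *)
exists h; split => //; exists (Z `\` N); split.
- exact: measurableD.
- apply: muN; [exact: measurableD| |by rewrite setIC setDIK].
  apply/eqP; rewrite eq_le measure_ge0 andbT -[X in (_ <= X)%E]Z0.
  by apply: le_measure; rewrite ?inE//; exact: measurableD.
- move=> x /= nx; split.
    apply: hZ => /= xZ; apply: nx.
    have [Ux|nUx] := pselect (U x); first by rewrite hU.
    by rewrite xZ.
  move=> Nx; apply: nx; rewrite hU//; exact: NU.
Qed.

End gradient_relaxation.

(** * Square-integrable functions and variance *)

Section square_integrable.
Context d (T : measurableType d) (R : realType) (P : probability T R).
Implicit Types (f g : T -> R).

Definition sq_integrable f :=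
  measurable_fun setT f /\ (\int[P]_x (f x ^+ 2)%:E < +oo)%E.

Lemma probability_integral_le1 (Y : T -> \bar R) : measurable_fun setT Y ->
  (forall x, 0 <= Y x <= 1)%E -> (0 <= \int[P]_x Y x <= 1)%E.
Proof.
move=> mY Y01; apply/andP; split.
  by apply: integral_ge0 => x _; have /andP[] := Y01 x.
apply: (@le_trans _ _ (\int[P]_x 1)%E); last first.
  by rewrite integral_cst//= probability_setT mule1.
by apply: ge0_le_integral => // x _; have /andP[] := Y01 x.
Qed.

Lemma measurable_sq f : measurable_fun setT f ->
  measurable_fun setT (fun x => (f x ^+ 2)%:E).
Proof. by move=> mf; apply/measurable_EFinP; exact: measurable_funX. Qed.

Lemma sq_integrable_dominated f (g : T -> \bar R) : measurable_fun setT f ->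
  measurable_fun setT g -> (forall x, (f x ^+ 2)%:E <= g x)%E ->
  (\int[P]_x g x < +oo)%E -> sq_integrable f.
Proof.
move=> mf mg fg goo; split => //; apply: le_lt_trans goo.
apply: ge0_le_integral => //; first by move=> x _; rewrite lee_fin sqr_ge0.
exact: measurable_sq.
Qed.

Lemma integrable_sqr f : sq_integrable f ->
  P.-integrable setT (EFin \o (fun x => f x ^+ 2)).
Proof.
move=> [mf foo]; apply/integrableP; split; first exact: measurable_sq.
by under eq_integral do rewrite /= ger0_norm ?sqr_ge0//.
Qed.

Lemma sq_integrable_integrable f : sq_integrable f -> P.-integrable setT (EFin \o f).
Proof.
move=> fL; have [mf foo] := fL.
apply: (@le_integrable _ _ _ P setT _ _ (EFin \o (fun x => 1 + f x ^+ 2))) => //.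
- exact/measurable_EFinP.
- move=> x _; rewrite /= lee_fin (ger0_norm (addr_ge0 _ (sqr_ge0 _)))//.
  rewrite -(real_normK (num_real (f x))).
  have := sqr_ge0 (`|f x| - 1); have := normr_ge0 (f x); nra.
- rewrite (_ : _ \o _ = (EFin \o cst 1%R) \+ (EFin \o (fun x => f x ^+ 2)%R))%E;
    last by [].
  by apply: integrableD => //; [exact: finite_measure_integrable_cst|exact:
      integrable_sqr].
Qed.

Lemma EFin_Rintegral f : P.-integrable setT (EFin \o f) ->
  (\int[P]_x (f x)%:E = (\int[P]_x f x)%:E)%E.
Proof. by move=> fi; rewrite /Rintegral fineK// integrable_fin_num. Qed.

Lemma integral_sqrB f c : sq_integrable f ->
  (\int[P]_x ((f x - c) ^+ 2)%:E =
   (\int[P]_x (f x ^+ 2) - 2 * c * \int[P]_x f x + c ^+ 2)%:E)%E.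
Proof.
move=> fL; have i1 := sq_integrable_integrable fL; have i2 := integrable_sqr fL.
have ic k : P.-integrable setT (EFin \o cst k) by exact:
    finite_measure_integrable_cst.
have i3 : P.-integrable setT (EFin \o (fun x => - (2 * c) * f x)).
  exact: (integrableZl measurableT _ i1).
have i4 : P.-integrable setT (EFin \o (fun x => - (2 * c) * f x + c ^+ 2)).
  exact: (integrableD measurableT i3 (ic _)).
have i5 : P.-integrable setT (EFin \o (fun x => f x ^+ 2 + (- (2 * c) * f x + c ^+
    2))).
  exact: (integrableD measurableT i2 i4).
under eq_integral => x _.
  have -> : (f x - c) ^+ 2 = f x ^+ 2 + (- (2 * c) * f x + c ^+ 2) by ring.
  over.
rewrite EFin_Rintegral//; congr EFin.
rewrite RintegralD// RintegralD//; last exact: ic.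
rewrite RintegralZl//.
rewrite (_ : \int[P]_x c ^+ 2 = c ^+ 2); last first.
  by rewrite Rintegral_cst//= probability_setT/= mulr1.
ring.
Qed.

Lemma varianceE_integral f :
  ('V_P[f] = \int[P]_x ((f x - \int[P]_y f y) ^+ 2)%:E)%E.
Proof.
rewrite /variance covariance.unlock expectation.unlock.
by under eq_integral => x _ do rewrite /= -expr2.
Qed.

Lemma integral_sqrB_variance f c : sq_integrable f ->
  (\int[P]_x ((f x - c) ^+ 2)%:E = 'V_P[f] + ((\int[P]_x f x - c) ^+ 2)%:E)%E.
Proof.
move=> fL; rewrite varianceE_integral !integral_sqrB// -EFinD; congr EFin; ring.
Qed.

(** The excess is the square of the distance from [c] to the mean. Hence the median in [C1] and [C2]
    can stand in for the mean. *)
Lemma variance_le_sqrB f c : sq_integrable f ->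
  ('V_P[f] <= \int[P]_x ((f x - c) ^+ 2)%:E)%E.
Proof.
by move=> fL; rewrite integral_sqrB_variance// leeDl// lee_fin sqr_ge0.
Qed.

Lemma sqr_Rintegral_le f : sq_integrable f ->
  (((\int[P]_x f x) ^+ 2)%:E <= \int[P]_x (f x ^+ 2)%:E)%E.
Proof.
move=> fL; have := integral_sqrB_variance 0 fL.
under eq_integral do rewrite subr0.
by rewrite subr0 => ->; rewrite leeDr// variance_ge0.
Qed.

(* (a + b)^2 <= (1 + t) a^2 + (1 + 1/t) b^2. *)
Lemma variance_lsc f (B : R) : sq_integrable f ->
  (forall e, 0 < e -> exists g, [/\ sq_integrable g,
     forall x, `|f x - g x| <= e & ('V_P[g] <= B%:E)%E]) ->
  ('V_P[f] <= B%:E)%E.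
Proof.
move=> fL approx.
have B0 : 0 <= B.
  have [g [_ _]] := approx 1 ltr01; rewrite -lee_fin; apply: le_trans.
  exact: variance_ge0.
(* With t equal to the distance [e] itself, the error (1 + 1/t) e^2 is e^2 + e. *)
have key e : 0 < e -> ('V_P[f] <= ((1 + e) * B + (e ^+ 2 + e))%:E)%E.
  move=> e0; have [g [gL fg gB]] := approx e e0.
  set m := \int[P]_x g x.
  apply: (le_trans (variance_le_sqrB m fL)).
  apply: (@le_trans _ _ (\int[P]_x ((1 + e)%:E * ((g x - m) ^+ 2)%:E + (e ^+ 2 +
      e)%:E))%E).
    have [mf _] := fL; have [mg _] := gL.
    apply: ge0_le_integral => //.
    - by move=> x _; rewrite lee_fin sqr_ge0.
    - by apply: measurable_sq; exact: measurable_funB.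
    - apply: emeasurable_funD => //; apply: emeasurable_funM => //.
      by apply: measurable_sq; exact: measurable_funB.
    - move=> x _; rewrite -EFinM -EFinD lee_fin.
      have := fg x; rewrite ler_norml => /andP[h1 h2].
      have := sqr_ge0 (e * (g x - m) - (f x - g x)).
      set a := g x - m; have -> : f x - m = a + (f x - g x) by rewrite /a; ring.
      move: h1 h2; set b := f x - g x => h1 h2 h3.
      have h4 : b ^+ 2 <= e ^+ 2 by nra.
      have h5 : 2 * a * b * e <= e ^+ 2 * a ^+ 2 + b ^+ 2 by nra.
      have h6 : 2 * a * b <= e * a ^+ 2 + e by rewrite -(ler_pM2r e0); nra.
      nra.
  rewrite ge0_integralD//; last 3 first.
  - by move=> x _; rewrite -EFinM lee_fin mulr_ge0 ?sqr_ge0// addr_ge0// ltW.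
  - apply: emeasurable_funM => //; apply: measurable_sq.
    by have [mg _] := gL; exact: measurable_funB.
  - by move=> x _; rewrite lee_fin addr_ge0 ?sqr_ge0// ltW.
  rewrite ge0_integralZl//; last 3 first.
  - by apply: measurable_sq; have [mg _] := gL; exact: measurable_funB.
  - by move=> x _; rewrite lee_fin sqr_ge0.
  - by rewrite lee_fin addr_ge0// ltW.
  rewrite -varianceE_integral integral_cst//= probability_setT mule1.
  rewrite [leRHS]EFinD [((1 + e) * B)%:E]EFinM leeD2r// lee_wpmul2l//.
  by rewrite lee_fin addr_ge0// ltW.
apply/lee_addgt0Pr => e e0; rewrite -EFinD.
(* For t <= 1 the excess t B + t^2 + t is at most t (B + 2), hence at most [e]. *)
pose t := Num.min 1 (e / (B + 2)).
have t0 : 0 < t by rewrite lt_min ltr01 divr_gt0// ltr_wpDl.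
have t1 : t <= 1 by rewrite ge_min lexx.
have te : t * (B + 2) <= e by rewrite -ler_pdivlMr ?ltr_wpDl// ge_min lexx orbT.
apply: (le_trans (key t t0)); rewrite lee_fin; nra.
Qed.

Lemma sq_integrableB f g : sq_integrable f -> sq_integrable g ->
  sq_integrable (f \- g).
Proof.
move=> [mf foo] [mg goo].
apply: (@sq_integrable_dominated _ (fun x => 2%:E * (f x ^+ 2)%:E + 2%:E * (g x ^+
    2)%:E)%E).
- exact: measurable_funB.
- by apply: emeasurable_funD; apply: emeasurable_funM => //; exact: measurable_sq.
- move=> x; rewrite -!EFinM -EFinD lee_fin /=.
  have := sqr_ge0 (f x + g x); nra.
rewrite ge0_integralD//; last 4 first.
- by move=> x _; rewrite -EFinM lee_fin mulr_ge0// sqr_ge0.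
- by apply: emeasurable_funM => //; exact: measurable_sq.
- by move=> x _; rewrite -EFinM lee_fin mulr_ge0// sqr_ge0.
- by apply: emeasurable_funM => //; exact: measurable_sq.
rewrite !ge0_integralZl//; try exact: measurable_sq;
  try by move=> x _; rewrite lee_fin sqr_ge0.
by rewrite lte_add_pinfty// lte_mul_pinfty// ?lee_fin//; apply: ltW.
Qed.

End square_integrable.

(** * Separately Lipschitz functions on tuples *)

Section caratheodory.
Context d (T : measurableType d) (R : realType).

(** Rounding the first variable down to the grid of mesh 1/(k+1) makes preimages countable unions of
    rectangles; the Lipschitz condition in that variable makes the rounded functions converge
    pointwise to F. *)
Lemma measurable_caratheodory (F : R * T -> R) :
  (forall t, measurable_fun setT (fun x => F (t, x))) ->
  (forall x, Lip1 (fun t => F (t, x))) -> measurable_fun setT F.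
Proof.
move=> mF lF.
pose q k (t : R) : R := (Num.floor (k.+1%:R * t))%:~R / k.+1%:R.
have qP k t : `|t - q k t| <= k.+1%:R^-1.
  rewrite /q; have k0 : 0 < k.+1%:R :> R by rewrite ltr0n.
  have /andP[h1 h2] := floor_itv (k.+1%:R * t).
  rewrite -(ler_pM2r k0) mulVf ?gt_eqF// -[X in _ * X](gtr0_norm k0) -normrM.
  rewrite mulrBl divfK ?gt_eqF// [t * _]mulrC ger0_norm ?subr_ge0//.
  by move: h2; rewrite intrD; lra.
apply: (@measurable_fun_cvg _ _ _ _ (fun k z => F (q k z.1, z.2))) => [k|[t x] _].
  move=> _ B mB; rewrite setTI.
  rewrite (_ : _ @^-1` B = \bigcup_(z in [set: int])
     ([set t | Num.floor (k.+1%:R * t) = z] `*`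
      [set x | B (F (z%:~R / k.+1%:R, x))])); last first.
    apply/seteqP; split => [[t x] /= Btx|[t x] [z _ [/= <-]]//].
    by exists (Num.floor (k.+1%:R * t)).
  apply: countable_bigcupT_measurable => // z; apply: measurableX; last first.
    by rewrite -[X in measurable X]setTI; exact: mF.
  rewrite (_ : [set t | _] = `[z%:~R / k.+1%:R, (z + 1)%:~R / k.+1%:R[%classic).
    exact: measurable_itv.
  have k0 : 0 < k.+1%:R :> R by rewrite ltr0n.
  apply/seteqP; split => t /=; rewrite in_itv/= ler_pdivrMr// ltr_pdivlMr// [t *
      _]mulrC.
    by move=> <-; exact: floor_itv.
  exact: floor_def.
apply/cvgrPdist_le => e e0; near=> k.
rewrite (le_trans (lF x _ _))// (le_trans (qP k t))//.
near: k; have [n hn] : exists n : nat, e^-1 <= n%:R.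
  by exists (Num.truncn e^-1).+1; apply/ltW/truncnS_gt.
exists n => // k /= nk.
rewrite -[leRHS]invrK lef_pV2 ?posrE ?invr_gt0// (le_trans hn)// ler_nat.
exact: leq_trans nk _.
Unshelve. all: by end_near. Qed.

End caratheodory.

Section tuple_functions.
Context {R : realType}.
Implicit Types (n : nat).

(** The variance argument needs only this: it does not mention p and survives freezing coordinates,
    which the induction on n requires. *)
Definition sep_lipschitz n (f : n.-tuple R -> R) :=
  forall x i e, `|f (shift_coord x i e) - f x| <= `|e|.

Lemma shift_coord_cons0 n (t : R) (x : n.-tuple R) e :
  shift_coord (cons_pair (t, x)) ord0 e = cons_pair (t + e, x).
Proof.
apply: eq_from_tnth => j; rewrite tnth_mktuple.
by case: (unliftP ord0 j) => [k ->|->]; rewrite /cons_pair ?tnthS ?tnth0.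
Qed.

Lemma shift_coord_consS n (t : R) (x : n.-tuple R) i e :
  shift_coord (cons_pair (t, x)) (lift ord0 i) e = cons_pair (t, shift_coord x i e).
Proof.
apply: eq_from_tnth => j; rewrite tnth_mktuple.
case: (unliftP ord0 j) => [k ->|->]; rewrite /cons_pair ?tnthS ?tnth0//.
by rewrite tnth_mktuple (inj_eq lift_inj).
Qed.

Lemma shift_coordD n (x : n.-tuple R) i e e' :
  shift_coord (shift_coord x i e) i e' = shift_coord x i (e + e').
Proof.
apply: eq_from_tnth => j; rewrite !tnth_mktuple.
by case: eqVneq => //; rewrite addrA.
Qed.

Lemma shift_coord0 n (x : n.-tuple R) i : shift_coord x i 0 = x.
Proof.
by apply: eq_from_tnth => j; rewrite tnth_mktuple; case: eqVneq; rewrite ?addr0.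
Qed.

Lemma shift_coordC n (x : n.-tuple R) i j e e' :
  shift_coord (shift_coord x i e) j e' = shift_coord (shift_coord x j e') i e.
Proof.
apply: eq_from_tnth => k; rewrite !tnth_mktuple.
by case: eqVneq => // _; case: eqVneq => // _; rewrite addrAC.
Qed.

Lemma cons_pairK n (x : n.+1.-tuple R) : cons_pair (thead x, [tuple of behead x]) = x.
Proof. by apply: val_inj; rewrite /= [in RHS](tuple_eta x). Qed.

Lemma sep_lipschitz_tail n (f : n.+1.-tuple R -> R) t : sep_lipschitz f ->
  sep_lipschitz (fun x => f (cons_pair (t, x))).
Proof. by move=> fL x i e; rewrite -shift_coord_consS. Qed.

Lemma sep_lipschitz_head n (f : n.+1.-tuple R -> R) x : sep_lipschitz f ->
  Lip1 (fun t => f (cons_pair (t, x))).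
Proof.
move=> fL s t; rewrite -{1}(subrK t s) [s - t + t]addrC -shift_coord_cons0.
exact: fL.
Qed.

Lemma sep_lipschitz_shift n (f : n.-tuple R -> R) i e : sep_lipschitz f ->
  sep_lipschitz (fun x => f (shift_coord x i e)).
Proof. by move=> fL x j e'; rewrite shift_coordC. Qed.

Lemma sep_lipschitz_line n (f : n.-tuple R -> R) x i : sep_lipschitz f ->
  Lip1 (fun e => f (shift_coord x i e)).
Proof.
move=> fL s t; rewrite -{1}(subrK t s) [s - t + t]addrC -shift_coordD.
exact: fL.
Qed.

(** Tuples carry the product sigma-algebra, so measurability is obtained by induction: Lipschitz in
    the head, measurable in the tail. *)
Lemma sep_lipschitz_measurable n (f : n.-tuple R -> R) : sep_lipschitz f ->
  measurable_fun setT f.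
Proof.
elim: n f => [f _|n IH f fL].
  rewrite (_ : f = cst (f [tuple]))//.
  by apply/funext => x; rewrite tuple0.
have -> : f = (fun z => f (cons_pair z)) \o
    (fun x : n.+1.-tuple R => (thead x, [tuple of behead x])).
  by apply/funext => x /=; rewrite cons_pairK.
apply: measurableT_comp.
  apply: measurable_caratheodory => [t|x].
    by apply: IH; exact: sep_lipschitz_tail.
  exact: sep_lipschitz_head.
apply: measurable_fun_pair; first exact: (measurable_tnth ord0).
exact: measurable_behead.
Qed.

Lemma lipschitz_p_sep p n (f : n.-tuple R -> R) : (0%E < p)%E -> lipschitz_p p f ->
  sep_lipschitz f.
Proof.
move=> p0 fL x i e; apply: (le_trans (fL _ _)); rewrite /dist_p.
have E j : `|tnth (shift_coord x i e) j - tnth x j| = if j == i then `|e| else 0.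
  rewrite tnth_mktuple; case: eqVneq => _; last by rewrite subrr normr0.
  by rewrite addrAC subrr add0r.
have le_max : \big[Num.max/0]_(j < n) `|tnth (shift_coord x i e) j - tnth x j| <=
    `|e|.
  apply: (big_ind (fun v => v <= `|e|)) => // [a b ae be|j _]; first by rewrite
      ge_max ae.
  by rewrite E; case: ifP.
case: p p0 fL => [r||]// r0 _.
(* The unshifted coordinates contribute 0 to the power r, which is 0 only because r is nonzero: the
   power 0 of 0 is 1. *)
rewrite (bigD1 i)//= big1 => [|j ji]; last first.
  by rewrite E (negbTE ji) powR0// gt_eqF.
rewrite addr0 E eqxx -powRrM mulfV ?powRr1//.
by rewrite gt_eqF.
Qed.

Definition psup n (f : n.-tuple R -> R) i x :=
  limsup0 (fun e => (f (shift_coord x i e) - f x) / e).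

Lemma partial_quot_le1 n (f : n.-tuple R -> R) i x e : sep_lipschitz f ->
  `|(f (shift_coord x i e) - f x) / e| <= 1.
Proof.
move=> fL; have [->|e0] := eqVneq e 0; first by rewrite invr0 mulr0 normr0.
by rewrite normrM normfV ler_pdivrMr ?normr_gt0// mul1r.
Qed.

Lemma partial_supE n (f : n.-tuple R -> R) i x : sep_lipschitz f ->
  partial_sup f i x = (psup f i x)%:E.
Proof. by move=> fL; rewrite -(@limsup0K _ _ 1)// => e; exact: partial_quot_le1. Qed.

Lemma norm_psup_le1 n (f : n.-tuple R -> R) i x : sep_lipschitz f ->
  `|psup f i x| <= 1.
Proof. by move=> fL; apply: norm_limsup0_le => e; exact: partial_quot_le1. Qed.

Lemma measurable_psup n (f : n.-tuple R -> R) i : sep_lipschitz f ->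
  measurable_fun setT (psup f i).
Proof.
move=> fL; apply: (@measurable_limsup0 _ _ _
  (fun x e => (f (shift_coord x i e) - f x) / e) 1).
- by move=> x e; exact: partial_quot_le1.
- move=> e _; apply: measurable_funM => //; apply: measurable_funB.
    by apply: sep_lipschitz_measurable; exact: sep_lipschitz_shift.
  exact: sep_lipschitz_measurable.
- move=> x e e0; apply: cvgM; last exact: cvgV.
  apply: cvgB; last exact: cvg_cst.
  exact: (lipschitz_continuous (sep_lipschitz_line x i fL)).
Qed.

Lemma psup_cons0 n (f : n.+1.-tuple R -> R) t x :
  psup f ord0 (cons_pair (t, x)) = dsup (fun s => f (cons_pair (s, x))) t.
Proof.
by apply: limsup0_eq => e _; rewrite shift_coord_cons0.
Qed.

Lemma psup_consS n (f : n.+1.-tuple R -> R) i t x :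
  psup f (lift ord0 i) (cons_pair (t, x)) = psup (fun y => f (cons_pair (t, y))) i x.
Proof. by apply: limsup0_eq => e _; rewrite shift_coord_consS. Qed.

End tuple_functions.

(** * Tonelli's theorem for the head and tail of a tuple, in both orders *)

Section power_tonelli.
Context {R : realType} (mu : probability R R) (n : nat).
Variable g : n.+1.-tuple R -> \bar R.
Hypothesis mg : measurable_fun setT g.
Hypothesis g0 : forall x, (0 <= g x)%E.
Notation P := (power_probability mu).

Let mG : measurable_fun setT (g \o @cons_pair _ R n).
Proof. by apply: measurableT_comp => //; exact: measurable_cons_pair. Qed.

Lemma power_tonelli1 :
  (\int[P n.+1]_z g z = \int[mu]_t \int[P n]_x g (cons_pair (t, x)))%E.
Proof.
rewrite [LHS]ge0_integral_distribution//.
by rewrite (fubini_tonelli1 (g \o @cons_pair _ R n))//=.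
Qed.

Lemma power_tonelli2 :
  (\int[P n.+1]_z g z = \int[P n]_x \int[mu]_t g (cons_pair (t, x)))%E.
Proof.
by rewrite power_tonelli1; apply: (fubini_tonelli (g \o @cons_pair _ R n)) => //=
    z; exact: g0.
Qed.

Lemma measurable_power_tonelli1 :
  measurable_fun setT (fun t => (\int[P n]_x g (cons_pair (t, x)))%E).
Proof. exact: (measurable_fun_fubini_tonelli_F _ mG (fun z => g0 _)). Qed.

Lemma measurable_power_tonelli2 :
  measurable_fun setT (fun x => (\int[mu]_t g (cons_pair (t, x)))%E).
Proof. exact: (measurable_fun_fubini_tonelli_G _ mG (fun z => g0 _)). Qed.

End power_tonelli.

(** * Concavity of powers *)

Section power_concavity.
Context {R : realType}.
Implicit Types (a s y : R).

Lemma le_poweR (r : R) (x y : \bar R) : 0 <= r -> (0 <= x)%E -> (x <= y)%E ->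
  (x `^ r <= y `^ r)%E.
Proof.
move=> r0 x0 xy; apply: gt0_ler_poweR => //; rewrite in_itv/= leey andbT//.
exact: le_trans xy.
Qed.

Lemma le_powR (r x y : R) : 0 <= r -> 0 <= x -> x <= y -> x `^ r <= y `^ r.
Proof.
by move=> r0 x0 xy; apply: ge0_ler_powR; rewrite ?nnegrE// (le_trans x0).
Qed.

(** A concave power lies below its tangent at s. This is Young's inequality for y^a and s^(1-a),
    with exponents 1/a and 1/(1-a), multiplied by s^(a-1). *)
Lemma powR_tangent a s y : 0 < a <= 1 -> 0 < s -> 0 <= y ->
  y `^ a <= a * s `^ (a - 1) * y + (1 - a) * s `^ a.
Proof.
move=> /andP[a0]; rewrite le_eqVlt => /predU1P[->|a1] s0 y0.
  by rewrite subrr powRr0 powRr1// mul0r addr0 !mul1r.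
have b0 : 0 < 1 - a by rewrite subr_gt0.
have /= := @conjugate_powR _ (y `^ a) (s `^ (1 - a)) a^-1 (1 - a)^-1
  (powR_ge0 _ _) (powR_ge0 _ _).
rewrite !invr_gt0 !invrK => /(_ a0 b0 (subrKC _ _)).
rewrite -!powRrM !mulfV ?gt_eqF// !powRr1// ?(ltW s0)// => h.
have sn : 0 < s `^ (a - 1) by exact: powR_gt0.
have {}h := ler_wpM2r (ltW sn) h.
have E : s `^ (1 - a) * s `^ (a - 1) = 1.
  rewrite -powRD; last by rewrite (gt_eqF s0) implybT.
  by rewrite (_ : 1 - a + (a - 1) = 0) ?powRr0//; ring.
rewrite -mulrA E mulr1 in h; apply: (le_trans h).
rewrite mulrDl -(mulr_powRB1 (ltW s0) a0).
by rewrite le_eqVlt; apply/orP; left; apply/eqP; ring.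
Qed.

(** Hoelder's inequality against the constant 1, obtained by summing the tangent inequality at the
    average of the [b i]. *)
Lemma sum_powR_le n (b : 'I_n -> R) a : (0 < n)%N -> 0 < a <= 1 ->
  (forall i, 0 <= b i) ->
  \sum_(i < n) b i `^ a <= n%:R `^ (1 - a) * (\sum_(i < n) b i) `^ a.
Proof.
move=> n0 a01 b0; have /andP[a0 a1] := a01.
have nR : 0 < n%:R :> R by rewrite ltr0n.
set S := \sum_(i < n) b i; have S0 : 0 <= S by exact: sumr_ge0.
have [SE|/negPf Sn0] := eqVneq S 0.
  rewrite big1 ?mulr_ge0 ?powR_ge0// => i _.
  have : b i <= S by rewrite /S (bigD1 i)//= lerDl sumr_ge0.
  by rewrite SE => bi; rewrite (@le_anti _ _ (b i) 0) ?bi ?b0// powR0 ?gt_eqF.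
have Sp : 0 < S by rewrite lt_neqAle S0 eq_sym Sn0.
have sp : 0 < S / n%:R by rewrite divr_gt0.
apply: (@le_trans _ _ (\sum_(i < n) (a * (S / n%:R) `^ (a - 1) * b i
    + (1 - a) * (S / n%:R) `^ a))).
  by apply: ler_sum => i _; exact: powR_tangent.
rewrite big_split/= -mulr_sumr -/S sumr_const card_ord.
rewrite -[_ * _ *+ n]mulr_natr.
have -> : n%:R `^ (1 - a) * S `^ a = (S / n%:R) `^ a * n%:R.
  have -> : S `^ a = (S / n%:R) `^ a * n%:R `^ a.
    by rewrite -powRM ?divfK ?(gt_eqF nR)// ltW.
  rewrite mulrCA -powRD; last by rewrite (gt_eqF nR) implybT.
  by rewrite subrK powRr1 ?(ltW nR).
rewrite -(mulr_powRB1 (ltW sp) a0).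
by rewrite le_eqVlt; apply/orP; left; apply/eqP; field; rewrite gt_eqF.
Qed.

(** Jensen's inequality: integrate the tangent inequality at the mean of Y. *)
Lemma integral_poweR_le d (T : measurableType d) (P : probability T R)
  (Y : T -> \bar R) a : 0 < a <= 1 -> measurable_fun setT Y ->
  (forall x, (0 <= Y x <= 1)%E) ->
  (\int[P]_x Y x `^ a <= (\int[P]_x Y x) `^ a)%E.
Proof.
move=> a01 mY Y01; have /andP[a0 a1] := a01.
have Y0 x : (0 <= Y x)%E by have /andP[] := Y01 x.
have I1 : (\int[P]_x Y x <= 1)%E.
  apply: (@le_trans _ _ (\int[P]_x 1)%E); last first.
    by rewrite integral_cst//= probability_setT mule1.
  by apply: ge0_le_integral => // x _; have /andP[] := Y01 x.
have I0 : (0 <= \int[P]_x Y x)%E by exact: integral_ge0.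
have If : (\int[P]_x Y x)%E \is a fin_num.
  by rewrite ge0_fin_numE// (le_lt_trans I1)// ltry.
set m := fine (\int[P]_x Y x)%E.
have m0 : 0 <= m by exact: fine_ge0.
have key s : 0 < s -> (\int[P]_x Y x `^ a <=
    (a * s `^ (a - 1) * m + (1 - a) * s `^ a)%:E)%E.
  move=> s0.
  have c0 : 0 <= a * s `^ (a - 1) by rewrite mulr_ge0 ?powR_ge0// ltW.
  have d0 : 0 <= (1 - a) * s `^ a by rewrite mulr_ge0 ?powR_ge0// subr_ge0.
  apply: (@le_trans _ _ (\int[P]_x ((a * s `^ (a - 1))%:E * Y x
     + ((1 - a) * s `^ a)%:E))%E).
    apply: ge0_le_integral => //.
    - by move=> x _; exact: poweR_ge0.
    - by apply: (measurableT_comp (measurable_poweR _)).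
    - by apply: emeasurable_funD => //; exact: emeasurable_funM.
    - move=> x _; have /andP[] := Y01 x.
      case: (Y x) => [y y0 y1| |]//.
      by rewrite poweR_EFin -EFinM -EFinD lee_fin powR_tangent.
  rewrite ge0_integralD//; last 2 first.
  - by move=> x _; rewrite mule_ge0.
  - exact: emeasurable_funM.
  rewrite ge0_integralZl// integral_cst//= probability_setT mule1.
  by rewrite -(fineK If) -/m -EFinM -EFinD.
rewrite -(fineK If) -/m poweR_EFin.
have [mE|/negPf mn0] := eqVneq m 0; last first.
  have mp : 0 < m by rewrite lt_neqAle m0 eq_sym mn0.
  apply: (le_trans (key m mp)); rewrite lee_fin -mulrA [_ * m]mulrC mulr_powRB1//.
  by rewrite le_eqVlt; apply/orP; left; apply/eqP; ring.
(* At mean 0 the tangent may be vertical. Tangents at a small s leave (1 - a) s^a, which the choice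
   s = e^(1/a) makes at most [e]. *)
rewrite mE powR0 ?gt_eqF//; apply/lee_addgt0Pr => e e0; rewrite add0e.
have sp : 0 < e `^ a^-1 by exact: powR_gt0.
apply: (le_trans (key _ sp)); rewrite mE mulr0 add0r -powRrM mulVf ?gt_eqF//.
rewrite powRr1 ?(ltW e0)// lee_fin ler_piMl ?(ltW e0)//; lra.
Qed.

End power_concavity.

(** * Tensorization *)

Section tensorization.
Context {R : realType} (mu : probability R R).
Notation P := (power_probability mu).
Implicit Types (n : nat).

Hypothesis mu2 : (\int[mu]_t (t ^+ 2)%:E < +oo)%E.

(** Induction on n: replacing the head t by 0 changes f by at most |t|, so f(t, x)^2 <= 2 f(0, x)^2
    + 2 t^2, and [mu2] handles the last term. *)
Lemma sep_lipschitz_sq_integrable n (f : n.-tuple R -> R) :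
  sep_lipschitz f -> sq_integrable (P n) f.
Proof.
elim: n f => [|n IH] f fL; have mf := sep_lipschitz_measurable fL.
  split => //; rewrite (_ : (fun x => _) = cst (f [tuple] ^+ 2)%:E); last first.
    by apply/funext => x; rewrite tuple0.
  by rewrite integral_cst//= -EFinM ltry.
split => //; rewrite power_tonelli1; last 2 first.
- exact: measurable_sq.
- by move=> x; rewrite lee_fin sqr_ge0.
have [mf0 f0oo] := IH _ (sep_lipschitz_tail 0 fL).
set A := (\int[P n]_x (f (cons_pair (0 : R, x)) ^+ 2)%:E)%E in f0oo.
have A0 : (0 <= A)%E by apply: integral_ge0 => x _; rewrite lee_fin sqr_ge0.
have mid : measurable_fun setT (fun t : R => (t ^+ 2)%:E) by exact: measurable_sq.
apply: (@le_lt_trans _ _ (\int[mu]_t (2%:E * A + 2%:E * (t ^+ 2)%:E))%E).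
  apply: ge0_le_integral => //.
  - by move=> t _; apply: integral_ge0 => x _; rewrite lee_fin sqr_ge0.
  - apply: (@measurable_power_tonelli1 _ mu n (fun z => (f z ^+ 2)%:E)).
      exact: measurable_sq.
    by move=> x; rewrite lee_fin sqr_ge0.
  - by apply: emeasurable_funD => //; exact: emeasurable_funM.
  move=> t _.
  have mt : measurable_fun setT (fun x => f (cons_pair (t, x))).
    by apply: sep_lipschitz_measurable; exact: sep_lipschitz_tail.
  apply: (@le_trans _ _ (\int[P n]_x (2%:E * (f (cons_pair (0 : R, x)) ^+ 2)%:E +
      (2 * t ^+ 2)%:E))%E).
    apply: ge0_le_integral => //.
    - by move=> x _; rewrite lee_fin sqr_ge0.
    - exact: measurable_sq.
    - apply: emeasurable_funD => //; apply: emeasurable_funM => //.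
      exact: measurable_sq.
    move=> x _; rewrite -EFinM -EFinD lee_fin.
    have := sep_lipschitz_head x fL t 0; rewrite subr0.
    set a := f _; set b := f _ => h.
    have h2 : (a - b) ^+ 2 <= t ^+ 2.
      by rewrite -(real_normK (num_real t)) -(real_normK (num_real (a - b)))
          lerXn2r ?nnegrE.
    have := sqr_ge0 (a - 2 * b); nra.
  rewrite ge0_integralD//; last 3 first.
  - by move=> x _; rewrite -EFinM lee_fin mulr_ge0// sqr_ge0.
  - by apply: emeasurable_funM => //; exact: measurable_sq.
  - by move=> x _; rewrite lee_fin mulr_ge0// sqr_ge0.
  rewrite ge0_integralZl//; last 2 first.
  - exact: measurable_sq.
  - by move=> x _; rewrite lee_fin sqr_ge0.
  by rewrite integral_cst//= probability_setT mule1 EFinM.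
rewrite ge0_integralD//; last 3 first.
- by move=> t _; rewrite mule_ge0.
- by move=> t _; rewrite mule_ge0// lee_fin sqr_ge0.
- exact: emeasurable_funM.
rewrite integral_cst//= probability_setT mule1 ge0_integralZl//; last first.
  by move=> t _; rewrite lee_fin sqr_ge0.
rewrite lte_add_pinfty// lte_mul_pinfty//.
Qed.

Lemma lipschitz_sq_integrable (g : R -> R) : Lip1 g -> sq_integrable mu g.
Proof.
move=> gL; have mg := lipschitz_measurable gL.
apply: (@sq_integrable_dominated _ _ _ mu g (fun t : R => (2 * g 0 ^+ 2)%:E + 2%:E
    * (t ^+ 2)%:E)%E) => //.
- by apply: emeasurable_funD => //; apply: emeasurable_funM => //; exact:
    measurable_sq.
- move=> t; rewrite -EFinM -EFinD lee_fin.
  have := gL t 0; rewrite subr0 => h.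
  have h2 : (g t - g 0) ^+ 2 <= t ^+ 2.
    by rewrite -(real_normK (num_real t)) -(real_normK (num_real (g t - g 0)))
        lerXn2r ?nnegrE.
  have := sqr_ge0 (g t - 2 * g 0); nra.
rewrite ge0_integralD//; last 3 first.
- by move=> t _; rewrite lee_fin mulr_ge0// sqr_ge0.
- by move=> t _; rewrite mule_ge0// lee_fin sqr_ge0.
- by apply: emeasurable_funM => //; exact: measurable_sq.
rewrite integral_cst//= probability_setT mule1 ge0_integralZl//; last 2 first.
- exact: measurable_sq.
- by move=> t _; rewrite lee_fin sqr_ge0.
by rewrite lte_add_pinfty ?ltry// lte_mul_pinfty.
Qed.

Variables (C alpha k : R).
Hypotheses (C0 : 0 <= C) (a01 : 0 < alpha <= 1) (k0 : 0 < k).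
Hypothesis poincare : forall g : R -> R, Lip1 g ->
  ('V_mu[g] <= C%:E * (\int[mu]_t (`|dsup g t| `^ k)%:E) `^ alpha)%E.

Let energy n (f : n.-tuple R -> R) i x : \bar R := (`|psup f i x| `^ k)%:E.

Let energy0 n (f : n.-tuple R -> R) i x : (0 <= energy f i x)%E.
Proof. by rewrite lee_fin powR_ge0. Qed.

Let energy1 n (f : n.-tuple R -> R) i x : sep_lipschitz f -> (energy f i x <= 1)%E.
Proof.
move=> fL; rewrite lee_fin (_ : 1 = 1 `^ k); last by rewrite powR1.
rewrite le_powR//; first exact: ltW.
exact: norm_psup_le1.
Qed.

Let menergy n (f : n.-tuple R -> R) i : sep_lipschitz f ->
  measurable_fun setT (energy f i).
Proof.
move=> fL; apply/measurable_EFinP.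
apply: (measurableT_comp (measurable_powR k)).
by apply: measurableT_comp => //; exact: measurable_psup.
Qed.

(* Efron-Stein by induction: conditionally on the first coordinate the
   variance splits into the variance in the tail and the square of the
   deviation of the conditional mean, and the latter is controlled by Jensen. *)
Lemma variance_tensorization n (f : n.-tuple R -> R) : sep_lipschitz f ->
  ('V_(P n)[f] <= \sum_(i < n) C%:E *
     (\int[P n]_x (`|psup f i x| `^ k)%:E) `^ alpha)%E.
Proof.
have a0 : 0 <= alpha by have /andP[/ltW] := a01.
elim: n f => [|n IH] f fL; have fL2 := sep_lipschitz_sq_integrable fL.
  apply: le_trans (variance_le_sqrB (f [tuple]) fL2) _.
  rewrite big_ord0 integral0_eq// => x _.
  by rewrite tuple0 subrr expr0n.
pose F t x := f (cons_pair (t, x)).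
have FtL t : sep_lipschitz (F t) by exact: sep_lipschitz_tail.
have FxL x : Lip1 (F ^~ x) by exact: sep_lipschitz_head.
(* Averaging out the head leaves a separately Lipschitz function of the tail, which is therefore
   square-integrable. *)
pose b x := \int[mu]_t F t x.
have bL : sep_lipschitz b.
  move=> x i e; rewrite /b -RintegralB//; last 2 first.
  - by apply: sq_integrable_integrable; apply: lipschitz_sq_integrable; exact: FxL.
  - by apply: sq_integrable_integrable; apply: lipschitz_sq_integrable; exact: FxL.
  have iB : mu.-integrable setT (EFin \o (fun t => F t (shift_coord x i e) - F t x)).
    apply: (@integrableB _ _ _ mu setT measurableT (EFin \o F ^~ _) (EFin \o F ^~ _));
      by apply: sq_integrable_integrable; apply: lipschitz_sq_integrable; exact: FxL.
  apply: (le_trans (le_normr_Rintegral _ iB)) => //.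
  apply: (@le_trans _ _ (\int[mu]_t (cst `|e| t))).
    apply: le_Rintegral => //; [exact: integrable_norm|exact:
        finite_measure_integrable_cst|].
    by move=> t _; exact: FtL.
  by rewrite Rintegral_cst//= probability_setT/= mulr1.
have bL2 := sep_lipschitz_sq_integrable bL.
pose c := \int[P n]_x b x.
apply: (le_trans (variance_le_sqrB c fL2)).
have mfc : measurable_fun setT (fun z : n.+1.-tuple R => ((f z - c) ^+ 2)%:E).
  by apply: measurable_sq; apply: measurable_funB => //; exact:
      sep_lipschitz_measurable.
rewrite power_tonelli1//; last by move=> z; rewrite lee_fin sqr_ge0.
pose tl (z : n.+1.-tuple R) := [tuple of behead z].
have tlE t x : tl (cons_pair (t, x)) = x by apply: val_inj.
(* Since [c] is the mean of [b], the mean of the slice [F t] deviates from [c] by the mean of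
   [F t - b]; [D] is the square of that integrand. *)
pose D z := ((f z - b (tl z)) ^+ 2)%:E.
have mD : measurable_fun setT D.
  apply: measurable_sq; apply: measurable_funB; first exact: sep_lipschitz_measurable.
  apply: measurableT_comp; first exact: sep_lipschitz_measurable.
  exact: measurable_behead.
have D0 z : (0 <= D z)%E by rewrite lee_fin sqr_ge0.
pose U i t := (\int[P n]_x energy f (lift ord0 i) (cons_pair (t, x)))%E.
have U01 i t : (0 <= U i t <= 1)%E.
  apply: probability_integral_le1 => [|x]; last by rewrite energy0 energy1.
  apply: (measurableT_comp (menergy (lift ord0 i) fL)).
  by apply: (measurableT_comp (@measurable_cons_pair _ R n)); exact: pair1_measurable.
have mU i : measurable_fun setT (U i).
  apply: (@measurable_power_tonelli1 _ mu n (energy f (lift ord0 i))) => [|z].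
    exact: menergy.
  exact: energy0.
pose W x := (\int[mu]_t energy f ord0 (cons_pair (t, x)))%E.
have W01 x : (0 <= W x <= 1)%E.
  apply: probability_integral_le1 => [|t]; last by rewrite energy0 energy1.
  apply: (measurableT_comp (menergy ord0 fL)).
  by apply: (measurableT_comp (@measurable_cons_pair _ R n)); exact: pair2_measurable.
have mW : measurable_fun setT W.
  apply: (@measurable_power_tonelli2 _ mu n (energy f ord0)) => [|z].
    exact: menergy.
  exact: energy0.
have mpow d (T : measurableType d) (Y : T -> \bar R) : measurable_fun setT Y ->
    measurable_fun setT (fun x => C%:E * Y x `^ alpha)%E.
  move=> mY; apply: emeasurable_funM => //.
  exact: (measurableT_comp (measurable_poweR _)).
have pow0 (y : \bar R) : (0 <= C%:E * y `^ alpha)%E by rewrite mule_ge0 ?poweR_ge0.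
apply: (@le_trans _ _ (\int[mu]_t ((\sum_(i < n) C%:E * (U i t) `^ alpha)
    + \int[P n]_x D (cons_pair (t, x))))%E).
  apply: ge0_le_integral => //.
  - by move=> t _; apply: integral_ge0 => x _; rewrite lee_fin sqr_ge0.
  - apply: (@measurable_power_tonelli1 _ mu n (fun z => ((f z - c) ^+ 2)%:E)) => // z.
    by rewrite lee_fin sqr_ge0.
  - apply: emeasurable_funD; last exact: measurable_power_tonelli1.
    by apply: emeasurable_sum => i; exact: mpow.
  move=> t _.
  have FtL2 := sep_lipschitz_sq_integrable (FtL t).
  rewrite (integral_sqrB_variance c FtL2) leeD//.
    apply: (le_trans (IH _ (FtL t))).
    by apply: lee_sum => i _; rewrite /U /energy; under eq_integral do rewrite
        -psup_consS.
  rewrite -RintegralB//; [|exact: sq_integrable_integrable..].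
  rewrite (_ : (\int[P n]_x D (cons_pair (t, x)))%E =
               (\int[P n]_x ((F t \- b) x ^+ 2)%:E)%E); last first.
    by apply: eq_integral => x _; rewrite /D tlE.
  exact: sqr_Rintegral_le (sq_integrableB FtL2 bL2).
rewrite ge0_integralD//; last 4 first.
- by move=> t _; exact: sume_ge0.
- by apply: emeasurable_sum => i; exact: mpow.
- by move=> t _; exact: integral_ge0.
- exact: measurable_power_tonelli1.
(* The induction hypothesis needed the head fixed. In the other order of integration, [D] becomes
   for each tail the variance of a Lipschitz function of the head, to which [poincare] applies. *)
rewrite big_ord_recl addeC leeD//.
  rewrite -power_tonelli1// power_tonelli2//.
  rewrite [X in (_ <= _ * X `^ _)%E](power_tonelli2 mu (menergy ord0 fL))//.
  apply: (@le_trans _ _ (\int[P n]_x (C%:E * W x `^ alpha))%E).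
    apply: ge0_le_integral => //.
    - by move=> x _; exact: integral_ge0.
    - exact: measurable_power_tonelli2.
    - exact: mpow.
    move=> x _; rewrite /D; under eq_integral do rewrite tlE.
    rewrite -/(b x) -varianceE_integral; apply: (le_trans (poincare (FxL x))).
    by rewrite /W /energy; under [in X in (_ <= X)%E]eq_integral do rewrite
        psup_cons0.
  rewrite ge0_integralZl//; last 2 first.
  - exact: (measurableT_comp (measurable_poweR _)).
  - by move=> x _; exact: poweR_ge0.
  by rewrite lee_wpmul2l// integral_poweR_le.
(* In the tail terms the average over the head is moved under the power [alpha] by Jensen, which
   turns the energies of slices into those of f. *)
rewrite ge0_integral_sum//; last by move=> i; exact: mpow.
apply: lee_sum => i _.
rewrite ge0_integralZl//; last 2 first.
- exact: (measurableT_comp (measurable_poweR _)).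
- by move=> x _; exact: poweR_ge0.
rewrite lee_wpmul2l//.
rewrite [X in (_ <= X `^ _)%E](power_tonelli1 mu (menergy (lift ord0 i) fL))//.
exact: integral_poweR_le.
Qed.

End tensorization.

(** * The one-dimensional inequality *)

Section one_dimensional_inequality.
Context {R : realType} (mu : probability R R).
Variables (c alpha k : R).
Hypotheses (c0 : 0 <= c) (a0 : 0 < alpha) (k0 : 0 < k).
Hypothesis gradient_ineq : forall h : R -> R, Lip1 h -> exists m,
  (\int[mu]_x ((h x - m) ^+ 2)%:E <=
     c%:E * (\int[mu]_x (abs_grad h x) `^ k) `^ alpha)%E.

Let poweR01 (y : \bar R) (r : R) : 0 < r -> (0 <= y <= 1)%E -> (0 <= y `^ r <= 1)%E.
Proof.
move=> r0 /andP[y0 y1]; rewrite poweR_ge0/=.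
rewrite (_ : 1%E = (1%E : \bar R) `^ r)%E; last by rewrite poweR_EFin powR1.
by rewrite le_poweR// ltW.
Qed.

Let abs_grad01 (h : R -> R) x : Lip1 h -> (0 <= abs_grad h x <= 1)%E.
Proof. by move=> hL; rewrite abs_grad_ge0 abs_grad_le1. Qed.

(** The identity is 1-Lipschitz with gradient at most 1, so [gradient_ineq] bounds its second moment
    about some [m]; then x^2 <= 2 (x - m)^2 + 2 m^2. *)
Lemma id_sq_integral_lty : (\int[mu]_t (t ^+ 2)%:E < +oo)%E.
Proof.
have idL : Lip1 (@idfun R) by move=> x y.
have [m hm] := gradient_ineq idL.
have mid r : measurable_fun setT (fun x : R => ((x - r) ^+ 2)%:E).
  by apply: measurable_sq; exact: measurable_funB.
have mabs : measurable_fun setT (fun x => abs_grad (@idfun R) x `^ k)%E.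
  exact: (measurableT_comp (measurable_poweR _) (measurable_abs_grad idL)).
have foo : (\int[mu]_x ((x - m) ^+ 2)%:E < +oo)%E.
  apply: (le_lt_trans hm).
  have /andP[i0 i1] := probability_integral_le1 mu mabs (fun x => poweR01 k0
      (abs_grad01 x idL)).
  have /andP[j0 j1] := poweR01 a0 (introT andP (conj i0 i1)).
  by rewrite lte_mul_pinfty// (le_lt_trans j1)// ltry.
apply: (@le_lt_trans _ _ (\int[mu]_x (2%:E * ((x - m) ^+ 2)%:E + (2 * m ^+ 2)%:E))%E).
  apply: ge0_le_integral => //.
  - by move=> x _; rewrite lee_fin sqr_ge0.
  - exact: measurable_sq.
  - by apply: emeasurable_funD => //; exact: emeasurable_funM.
  - move=> x _; rewrite -EFinM -EFinD lee_fin.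
    have := sqr_ge0 (x - 2 * m); nra.
rewrite ge0_integralD//; last 3 first.
- by move=> x _; rewrite -EFinM lee_fin mulr_ge0// sqr_ge0.
- exact: emeasurable_funM.
- by move=> x _; rewrite lee_fin mulr_ge0// sqr_ge0.
rewrite integral_cst//= probability_setT mule1 ge0_integralZl//; last first.
  by move=> x _; rewrite lee_fin sqr_ge0.
by rewrite lte_add_pinfty ?ltry// lte_mul_pinfty.
Qed.

(** The relaxed functions [h] tend uniformly to g, and their gradients are [mu]-a.e. at most
    |[dsup g]|. The bound on their variances is thus free of [e] and passes to the limit by
    [variance_lsc]. *)
Lemma variance_dsup_le (g : R -> R) : Lip1 g ->
  ('V_mu[g] <= c%:E * (\int[mu]_t (`|dsup g t| `^ k)%:E) `^ alpha)%E.
Proof.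
move=> gL.
have mdg : measurable_fun setT (fun t => (`|dsup g t| `^ k)%:E).
  apply/measurable_EFinP; apply: (measurableT_comp (measurable_powR k)).
  by apply: measurableT_comp => //; exact: measurable_dsup.
have /andP[i0 i1] : (0 <= \int[mu]_t (`|dsup g t| `^ k)%:E <= 1)%E.
  apply: probability_integral_le1 => // t.
  by rewrite -poweR_EFin poweR01// !lee_fin normr_ge0 norm_dsup_le1.
set I := (\int[mu]_t (`|dsup g t| `^ k)%:E)%E in i0 i1 *.
have If : I \is a fin_num by rewrite ge0_fin_numE// (le_lt_trans i1)// ltry.
rewrite -(fineK If) poweR_EFin -EFinM.
apply: variance_lsc; first exact: (lipschitz_sq_integrable id_sq_integral_lty).
move=> e e0; have [h [hL gh hgrad]] := abs_grad_relaxation mu gL e0.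
have hL2 := lipschitz_sq_integrable id_sq_integral_lty hL.
exists h; split => //.
have [m hm] := gradient_ineq hL.
apply: (le_trans (variance_le_sqrB m hL2)); apply: (le_trans hm).
rewrite EFinM -poweR_EFin fineK// lee_wpmul2l//.
apply: le_poweR; first exact: ltW.
  by apply: integral_ge0 => x _; exact: poweR_ge0.
apply: ae_ge0_le_integral => //.
- by move=> x _; exact: poweR_ge0.
- exact: (measurableT_comp (measurable_poweR _) (measurable_abs_grad hL)).
apply: ae_imply hgrad => x hx _; rewrite -poweR_EFin.
by apply: le_poweR => //; [exact: ltW|exact: abs_grad_ge0].
Qed.

End one_dimensional_inequality.

Section C1_C2.
Context {R : realType} (mu : probability R R) (alpha : R).
Hypothesis a0 : 0 < alpha.

(** The delicate case is b = 0: there A / b is +oo unless A = 0, so a finite C forces A = 0. *)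
Lemma lee_mul_of_div (A b C : \bar R) : (0 <= A)%E -> (0 <= b)%E ->
  (b < +oo)%E -> (C < +oo)%E -> (A / b <= C)%E -> (A <= C * b)%E.
Proof.
move=> A0 b0 boo Coo AbC.
have bf : b \is a fin_num by rewrite ge0_fin_numE.
have [bE|bn0] := eqVneq b 0%E; last first.
  have := lee_wpmul2r b0 AbC.
  by rewrite -muleA mulVe// mule1.
move: AbC; rewrite bE inve0 mule0; have [->//|An0] := eqVneq A 0%E.
rewrite gt0_muley ?lt0e ?An0// => h; exfalso.
by have := le_lt_trans h Coo; rewrite ltxx.
Qed.

Lemma C1_ge0 beta : (0 <= C1 mu alpha beta)%E.
Proof.
apply: le_trans (ereal_sup_ubound _); last by exists (cst 0) => // x y; rewrite
    subrr normr0.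
apply: mule_ge0; first by apply: integral_ge0 => x _; rewrite lee_fin powR_ge0.
by rewrite inve_ge0 poweR_ge0.
Qed.

Lemma C2_ge0 : (0 <= C2 mu alpha)%E.
Proof.
apply: le_trans (ereal_sup_ubound _); last by exists (cst 0) => // x y; rewrite
    subrr normr0.
apply: mule_ge0; first by apply: integral_ge0 => x _; rewrite lee_fin sqr_ge0.
by rewrite inve_ge0 poweR_ge0.
Qed.

Let integral_abs_grad_lty (k : R) (h : R -> R) : 0 < k -> Lip1 h ->
  ((\int[mu]_x (abs_grad h x) `^ k) `^ alpha < +oo)%E.
Proof.
move=> k0 hL.
have m1 : measurable_fun setT (fun x => abs_grad h x `^ k)%E.
  exact: (measurableT_comp (measurable_poweR _) (measurable_abs_grad hL)).
have /andP[i0 i1] : (0 <= \int[mu]_x (abs_grad h x) `^ k <= 1)%E.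
  apply: probability_integral_le1 => // x; rewrite poweR_ge0/=.
  rewrite (_ : 1%E = (1%E : \bar R) `^ k)%E; last by rewrite poweR_EFin powR1.
  by rewrite le_poweR ?abs_grad_ge0 ?abs_grad_le1// ltW.
apply: le_lt_trans (ltry 1).
rewrite (_ : 1%E = (1%E : \bar R) `^ alpha)%E; last by rewrite poweR_EFin powR1.
by rewrite le_poweR// ltW.
Qed.

Lemma C1_gradient_ineq : (C1 mu alpha 2 < +oo)%E ->
  forall h : R -> R, Lip1 h -> exists m,
  (\int[mu]_x ((h x - m) ^+ 2)%:E <=
     (fine (C1 mu alpha 2))%:E * (\int[mu]_x (abs_grad h x) `^ 1) `^ alpha)%E.
Proof.
move=> Coo h hL; exists (median mu h).
rewrite fineK ?ge0_fin_numE ?C1_ge0//.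
apply: lee_mul_of_div => //.
- by apply: integral_ge0 => x _; rewrite lee_fin sqr_ge0.
- exact: poweR_ge0.
- exact: integral_abs_grad_lty.
apply: ereal_sup_ubound; exists h => //; congr (_ / _ `^ _)%E.
  apply: eq_integral => x _.
  by rewrite powR_mulrn ?normr_ge0// real_normK ?num_real.
by apply: eq_integral => x _; rewrite poweRe1// abs_grad_ge0.
Qed.

Lemma C2_gradient_ineq : (C2 mu alpha < +oo)%E ->
  forall h : R -> R, Lip1 h -> exists m,
  (\int[mu]_x ((h x - m) ^+ 2)%:E <=
     (fine (C2 mu alpha))%:E * (\int[mu]_x (abs_grad h x) `^ 2) `^ alpha)%E.
Proof.
move=> Coo h hL; exists (median mu h).
rewrite fineK ?ge0_fin_numE ?C2_ge0//.
apply: lee_mul_of_div => //.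
- by apply: integral_ge0 => x _; rewrite lee_fin sqr_ge0.
- exact: poweR_ge0.
- by apply: integral_abs_grad_lty.
apply: ereal_sup_ubound; exists h => //; congr (_ / _ `^ _)%E.
  by apply: eq_integral => x _; rewrite real_normK ?num_real.
apply: eq_integral => x _; have := abs_grad_ge0 h x; rewrite abs_gradE// lee_fin =>
    g0.
by rewrite poweR_EFin powR_mulrn.
Qed.

End C1_C2.

(** * From the tensorized inequality to a single sum of q-th moments *)

Section sum_of_energies.
Context {R : realType} (mu : probability R R).
Notation P := (power_probability mu).
Variables (c alpha k q : R).
Hypotheses (c0 : 0 <= c) (a01 : 0 < alpha <= 1) (k0 : 0 < k) (kq : k <= q).
Hypothesis gradient_ineq : forall h : R -> R, Lip1 h -> exists m,
  (\int[mu]_x ((h x - m) ^+ 2)%:E <=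
     c%:E * (\int[mu]_x (abs_grad h x) `^ k) `^ alpha)%E.

Lemma measurable_norm_psup_powR n (f : n.-tuple R -> R) i (r : R) :
  sep_lipschitz f -> measurable_fun setT (fun x => (`|psup f i x| `^ r)%:E).
Proof.
move=> fL; apply/measurable_EFinP; apply: (measurableT_comp (measurable_powR r)).
by apply: measurableT_comp => //; exact: measurable_psup.
Qed.

Lemma norm_psup_powR01 n (f : n.-tuple R -> R) i (r : R) x : 0 < r ->
  sep_lipschitz f -> (0 <= (`|psup f i x| `^ r)%:E <= 1)%E.
Proof.
move=> r0 fL; rewrite !lee_fin powR_ge0/= (_ : 1 = 1 `^ r); last by rewrite powR1.
by rewrite le_powR ?norm_psup_le1// ltW.
Qed.

Lemma integral_psup01 n (f : n.-tuple R -> R) i (r : R) : 0 < r ->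
  sep_lipschitz f -> (0 <= \int[P n]_x (`|psup f i x| `^ r)%:E <= 1)%E.
Proof.
move=> r0 fL; apply: probability_integral_le1 => [|x].
  exact: measurable_norm_psup_powR.
exact: norm_psup_powR01.
Qed.

(** Write alpha k/q as (k/q) alpha. Jensen with the power k/q <= 1 replaces k-th by q-th moments in
    each term, and [sum_powR_le] with the power alpha k/q gathers the n terms, at the cost of the
    power of n. *)
Lemma variance_le_sum_psup n (f : n.-tuple R -> R) : (0 < n)%N -> sep_lipschitz f ->
  ('V_(P n)[f] <= c%:E * (n%:R `^ (1 - alpha * k / q))%:E *
     (\sum_(i < n) \int[P n]_x (`|psup f i x| `^ q)%:E) `^ (alpha * k / q))%E.
Proof.
move=> n0 fL; have /andP[a0 a1] := a01.
have q0 : 0 < q by exact: lt_le_trans kq.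
have mu2 := id_sq_integral_lty c0 a0 k0 gradient_ineq.
have poincare := variance_dsup_le c0 a0 k0 gradient_ineq.
apply: (le_trans (variance_tensorization mu2 c0 a01 k0 poincare fL)).
pose b i := fine (\int[P n]_x (`|psup f i x| `^ q)%:E).
have b01 i := integral_psup01 i q0 fL.
have bE i : (\int[P n]_x (`|psup f i x| `^ q)%:E = (b i)%:E)%E.
  have /andP[h0 h1] := b01 i.
  by rewrite fineK// ge0_fin_numE// (le_lt_trans h1)// ltry.
have b0 i : 0 <= b i by have /andP[+ _] := b01 i; rewrite bE lee_fin.
have theta : 0 < alpha * k / q <= 1.
  rewrite divr_gt0 ?mulr_gt0//= ler_pdivrMr// mul1r.
  by rewrite (le_trans _ kq)// ler_piMl// ltW.
apply: (@le_trans _ _ (\sum_(i < n) c%:E * (b i `^ (alpha * k / q))%:E)%E).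
  apply: lee_sum => i _; rewrite lee_wpmul2l// -poweR_EFin -bE.
  rewrite (_ : alpha * k / q = k / q * alpha); last by ring.
  have kq1 : 0 < k / q <= 1 by rewrite divr_gt0//= ler_pdivrMr// mul1r.
  have /andP[g0 g1] := integral_psup01 i k0 fL.
  apply: (@le_trans _ _ (((\int[P n]_x (`|psup f i x| `^ q)%:E) `^ (k / q)) `^
      alpha)%E).
    apply: le_poweR => //; first exact: ltW.
    have := @integral_poweR_le _ _ _ (P n) (fun x => (`|psup f i x| `^ q)%:E) _ kq1
      (measurable_norm_psup_powR i q fL) (fun x => norm_psup_powR01 i x q0 fL).
    apply: le_trans.
    rewrite le_eqVlt; apply/orP; left; apply/eqP; apply: eq_integral => x _.
    by rewrite poweR_EFin -powRrM mulrCA mulfV ?mulr1 ?gt_eqF.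
  by rewrite bE !poweR_EFin -powRrM.
rewrite -ge0_sume_distrr; last by move=> i _; rewrite lee_fin powR_ge0.
rewrite -muleA lee_wpmul2l// sumEFin.
under [in leRHS]eq_bigr do rewrite bE.
rewrite sumEFin poweR_EFin -EFinM lee_fin.
exact: sum_powR_le.
Qed.

End sum_of_energies.

(** * Gradients and the dual norm *)

Section dual_norm.
Context {R : realType}.

Definition norm_p (p : \bar R) n (v : 'I_n -> R) : R :=
  if p is r%:E then (\sum_(i < n) `|v i| `^ r) `^ r^-1
  else \big[Num.max/0]_(i < n) `|v i|.

(** Test with the extremal vector of Hoelder's inequality, sg(D_i) |D_i|^(q-1): the pairing is the
    sum S and the norm is S^(1/r), so S <= S^(1/r), which fails for S > 1. For p = +oo the signs of
    the D_i serve. *)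
Lemma sum_powR_dual_le1 (p : \bar R) n (D : 'I_n -> R) : (1 < p)%E ->
  (forall v : 'I_n -> R, \sum_(i < n) v i * D i <= norm_p p v) ->
  \sum_(i < n) `|D i| `^ conj_exp p <= 1.
Proof.
case: p => [r| |]//= r1 h; last first.
  apply: (@le_trans _ _ (\sum_(i < n) Num.sg (D i) * D i)).
    by apply: ler_sum => i _; rewrite powRr1// normrEsg.
  apply: (le_trans (h (fun i => Num.sg (D i)))).
  apply: (big_ind (fun v => v <= 1)) => // [a b a1 b1|i _]; first by rewrite ge_max
      a1.
  by rewrite normr_sg; case: (_ == _).
rewrite lte_fin in r1.
have r0 : 0 < r by exact: lt_trans r1.
have rm : 0 < r - 1 by rewrite subr_gt0.
pose q := r / (r - 1).
have q1 : q - 1 = (r - 1)^-1 by rewrite /q; field; rewrite gt_eqF.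
have q0 : 0 < q by rewrite divr_gt0.
set S := \sum_(i < n) _.
have S0 : 0 <= S by apply: sumr_ge0 => i _; exact: powR_ge0.
have : S <= S `^ r^-1.
  have := h (fun i => Num.sg (D i) * `|D i| `^ (q - 1)).
  congr (_ <= _).
    apply: eq_bigr => i _; rewrite mulrAC -normrEsg mulr_powRB1//.
  congr (_ `^ _); apply: eq_bigr => i _.
  have [->|Di0] := eqVneq (D i) 0.
    by rewrite sgr0 mul0r normr0 !powR0 ?gt_eqF.
  rewrite normrM normr_sg Di0 mul1r (ger0_norm (powR_ge0 _ _)) -powRrM q1.
  by rewrite mulrC.
rewrite leNgt => SS; rewrite leNgt; apply/negP => S1; apply/negP : SS.
rewrite negbK.
have Sp : 0 < S by exact: lt_trans S1.
have e0 : 0 < 1 - r^-1 by rewrite subr_gt0 invf_lt1.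
have E : S = S `^ (1 - r^-1) * S `^ r^-1.
  by rewrite -powRD ?subrK ?powRr1//; rewrite (gt_eqF Sp) implybT.
rewrite [X in _ < X]E ltr_pMl ?powR_gt0//.
rewrite /powR (gt_eqF Sp) -[ltLHS]expR0 ltr_expR mulr_gt0// ln_gt0//.
Qed.

Definition add_coord n (x : n.-tuple R) (v : 'I_n -> R) : n.-tuple R :=
  [tuple tnth x i + v i | i < n].

Lemma dist_p_add p n (x : n.-tuple R) (v : 'I_n -> R) (e : R) : (1 < p)%E -> 0 < e ->
  dist_p p (add_coord x (fun i => e * v i)) x = e * norm_p p v.
Proof.
move=> p1 e0; have E i : `|tnth (add_coord x (fun i => e * v i)) i - tnth x i| = e
    * `|v i|.
  by rewrite tnth_mktuple addrAC subrr add0r normrM gtr0_norm.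
case: p p1 => [r| |]//= r1; last first.
  under eq_bigr do rewrite E.
  elim/big_ind2 : _ => [|a b c d -> ->|//]; first by rewrite mulr0.
  by rewrite maxr_pMr// ltW.
rewrite lte_fin in r1; have r0 : 0 < r by exact: lt_trans r1.
under eq_bigr do rewrite E powRM ?(ltW e0)//.
rewrite -mulr_sumr powRM ?powR_ge0 ?sumr_ge0//.
by rewrite -powRrM mulfV ?gt_eqF// powRr1// ltW.
Qed.

(** For each direction and tolerance a single positive step with a first-order expansion is enough,
    by homogeneity of the distance. The weak form suits both points of differentiability and
    smoothed functions. *)
Lemma lipschitz_p_gradient p n (f : n.-tuple R -> R) x (D : 'I_n -> R) :
  (1 < p)%E -> lipschitz_p p f ->
  (forall v eta, 0 < eta -> exists2 e, 0 < e &
    `|f (add_coord x (fun i => e * v i)) - f x - e * \sum_(i < n) v i * D i| <= eta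
        * e) ->
  \sum_(i < n) `|D i| `^ conj_exp p <= 1.
Proof.
move=> p1 fL fD; apply: sum_powR_dual_le1 => // v.
apply/ler_addgt0Pr => eta eta0; have [e e0 h] := fD v eta eta0.
have := fL (add_coord x (fun i => e * v i)) x; rewrite dist_p_add// => h2.
rewrite -(ler_pM2l e0) mulrDr.
move: h h2; rewrite !ler_norml => /andP[h1 h2] /andP[h3 h4]; lra.
Qed.

(** The differential is linear in the direction, and its values on the unit vectors are the
    [psup f i x]. *)
Lemma differentiable_tuple_gradient p n (f : n.-tuple R -> R) x : (1 < p)%E ->
  lipschitz_p p f -> differentiable_tuple f x ->
  \sum_(i < n) `|psup f i x| `^ conj_exp p <= 1.
Proof.
move=> p1 fL dfx.
pose F (v : 'rV[R]_n) := f [tuple v 0 i | i < n].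
pose X : 'rV[R]_n := \row_i tnth x i.
have dF : differentiable F X by exact: dfx.
have FE v h : F (h *: (\row_i v i) + X) = f (add_coord x (fun i => h * v i)).
  congr f; apply: eq_from_tnth => i; rewrite !tnth_mktuple !mxE.
  by rewrite addrC.
have FX : F X = f x.
  by congr f; apply: eq_from_tnth => i; rewrite !tnth_mktuple !mxE.
have dirF v : h^-1 * (f (add_coord x (fun i => h * v i)) - f x) @[h --> 0^'] -->
    'd F X (\row_i v i).
  have := @diff_derivable _ _ _ F X (\row_i v i) dF.
  rewrite /derivable => /cvg_ex [l hl].
  have := deriveE (\row_i v i) dF; rewrite /derive.
  rewrite (cvg_lim _ hl)// => <-.
  move: hl; apply: cvg_trans; apply: near_eq_cvg; near=> h.
  by rewrite /= FE FX.
have dE i : psup f i x = 'd F X (delta_mx 0 i).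
  apply: limsup0_cvg.
  have := dirF (fun j => (j == i)%:R).
  have -> : \row_j (j == i)%:R = delta_mx 0 i :> 'rV[R]_n.
    by apply/rowP => j; rewrite !mxE eqxx.
  apply: cvg_trans; apply: near_eq_cvg; near=> h.
  rewrite mulrC; congr ((f _ - _) / _).
  apply: eq_from_tnth => j; rewrite !tnth_mktuple.
  by case: eqVneq => _; rewrite ?mulr1 ?mulr0 ?addr0.
apply: (lipschitz_p_gradient (x := x) p1 fL) => v eta eta0.
have dv : 'd F X (\row_i v i) = \sum_(i < n) v i * psup f i x.
  rewrite [X in 'd F _ X]row_sum_delta linear_sum; apply: eq_bigr => i _.
  by rewrite linearZ/= mxE dE.
have := dirF v; rewrite dv => /cvgrPdist_lt /(_ eta eta0) [d /= d0 hd].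
exists (d / 2); first by rewrite divr_gt0.
have := hd (d / 2).
have d2 : 0 < d / 2 by rewrite divr_gt0.
rewrite /= sub0r normrN gtr0_norm// ltr_pdivrMr// ltr_pMr// ltrDl ltr01.
move=> /(_ isT (lt0r_neq0 d2)).
set s := \sum_(i < n) _; set y := f _ - _ => h.
rewrite -[y](mulVKf (lt0r_neq0 d2)) -mulrBr normrM gtr0_norm// mulrC distrC.
by rewrite ler_pM2r// ltW.
Unshelve. all: by end_near. Qed.

End dual_norm.

(** * Smoothing by coordinatewise averages *)

Section averaging.
Context {R : realType}.
Notation lambda := (@lebesgue_measure R).
Implicit Types (phi psi : R -> R).

Lemma continuous_integrable_itv phi (a b : R) : continuous phi ->
  lambda.-integrable `[a, b] (EFin \o phi).
Proof.
move=> cphi; apply: continuous_compact_integrable; first exact: segment_compact.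
exact: continuous_subspaceT.
Qed.

Lemma Rintegral_shift phi (e s : R) : continuous phi -> 0 <= s ->
  \int[lambda]_(u in `[0, s]) phi (u + e) = \int[lambda]_(u in `[e, s + e]) phi u.
Proof.
move=> cphi s0; pose F (u : R) := u + e.
have F' : derive1 F = cst 1.
  apply/funext => u; rewrite derive1E deriveD//= derive_id derive_cst addr0//.
rewrite /Rintegral; congr fine.
have -> : `[e, s + e]%classic = `[F 0, F s]%classic by rewrite /F add0r.
rewrite (@integration_by_substitution_increasing _ F phi 0 s)//.
- by apply: eq_integral => u _; rewrite F' /= mulr1.
- by move=> x y _ _ xy; rewrite /F ltrD2r.
- by rewrite F' => x _; exact: cvg_cst.
- by rewrite F'; exact: is_cvg_cst.
- by rewrite F'; exact: is_cvg_cst.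
- split.
  + by move=> x _; rewrite /F; exact: derivableD.
  + by apply: cvg_at_right_filter; apply: cvgD; [exact: cvg_id|exact: cvg_cst].
  + by apply: cvg_at_left_filter; apply: cvgD; [exact: cvg_id|exact: cvg_cst].
- exact: continuous_subspaceT.
Qed.

Lemma Rintegral_itv_split phi (a b c : R) : continuous phi -> a <= b -> b <= c ->
  \int[lambda]_(u in `[a, c]) phi u =
  \int[lambda]_(u in `[a, b]) phi u + \int[lambda]_(u in `[b, c]) phi u.
Proof.
move=> cphi ab bc; rewrite -(@Rintegral_itv_obnd_cbnd _ b); last first.
  by apply: (integrableS _ _ _ (continuous_integrable_itv b c cphi)) => //; exact:
      subset_itv_oc_cc.
by rewrite -(@Rintegral_itvB _ phi (BLeft a) (BRight c) b)//;
  [rewrite addrC subrK|exact: continuous_integrable_itv].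
Qed.

Definition avg (s : R) phi := s^-1 * \int[lambda]_(u in `[0, s]) phi u.

Lemma norm_Rintegral_le phi (a b c : R) : continuous phi -> a <= b ->
  (forall u, a <= u <= b -> `|phi u| <= c) ->
  `|\int[lambda]_(u in `[a, b]) phi u| <= c * (b - a).
Proof.
move=> cphi ab phic; have ip := continuous_integrable_itv a b cphi.
apply: (le_trans (le_normr_Rintegral _ ip)) => //.
apply: (@le_trans _ _ (\int[lambda]_(u in `[a, b]) (cst c u))).
  apply: le_Rintegral => //; first exact: integrable_norm.
  by apply: continuous_integrable_itv => ?; exact: cvg_cst.
rewrite Rintegral_cst//= lebesgue_measure_itv/= lte_fin.
have [_|ba] := ltP a b; first exact: lexx.
have -> : a = b by lra.
by rewrite subrr mulr0.
Qed.

Lemma norm_avg_le (s : R) phi c : 0 < s -> continuous phi ->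
  (forall u, 0 <= u <= s -> `|phi u| <= c) -> `|avg s phi| <= c.
Proof.
move=> s0 cphi phic; rewrite /avg normrM gtr0_norm ?invr_gt0//.
rewrite mulrC ler_pdivrMr//.
by have := norm_Rintegral_le cphi (ltW s0) phic; rewrite subr0.
Qed.

Lemma avgB (s : R) phi psi : continuous phi -> continuous psi ->
  avg s (phi \- psi) = avg s phi - avg s psi.
Proof.
move=> cphi cpsi; rewrite /avg -mulrBr; congr (_ * _).
by apply: RintegralB => //; exact: continuous_integrable_itv.
Qed.

Lemma avgZ (s : R) c phi : continuous phi ->
  avg s (fun u => c * phi u) = c * avg s phi.
Proof.
move=> cphi; rewrite /avg mulrCA; congr (_ * _).
by apply: RintegralZl => //; exact: continuous_integrable_itv.
Qed.

Lemma avg_cst (s c : R) : 0 < s -> avg s (cst c) = c.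
Proof.
move=> s0; rewrite /avg Rintegral_cst//= lebesgue_measure_itv/= lte_fin s0.
by rewrite -EFinB/= subr0 mulrC mulfK ?gt_eqF.
Qed.

(** Shifting the window [0, s] by e gains the integral over [s, s+e] and loses that over [0, e].
    Each is within e^2 of e times the value at its left end; dividing by s gives the constant 2 /
    s. *)
Lemma avg_quadratic (s : R) phi e : 0 < s -> Lip1 phi -> 0 <= e ->
  `|avg s (fun u => phi (u + e)) - avg s phi - e * ((phi s - phi 0) / s)|
    <= 2 / s * e ^+ 2.
Proof.
move=> s0 pL e0; have cphi := lipschitz_continuous pL.
rewrite /avg Rintegral_shift ?(ltW s0)//.
have split1 := @Rintegral_itv_split phi 0 s (s + e) cphi (ltW s0) ltac:(lra).
have split2 := @Rintegral_itv_split phi 0 e (s + e) cphi e0 ltac:(lra).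
have near_value a : `|\int[lambda]_(u in `[a, a + e]) phi u - e * phi a| <= e ^+ 2.
  have ic : \int[lambda]_(u in `[a, a + e]) (cst (phi a) u) = e * phi a.
    rewrite Rintegral_cst//= lebesgue_measure_itv/= lte_fin.
    have [_|ba] := ltP a (a + e); first by rewrite -EFinB/=; ring.
    have -> : e = 0 by lra.
    by rewrite mulr0 mul0r.
  have cc : continuous (cst (phi a) : R -> R) by move=> ?; exact: cvg_cst.
  rewrite -ic -RintegralB//; [|exact: continuous_integrable_itv..].
  have cd : continuous (phi \- cst (phi a)).
    by move=> u; apply: cvgB; [exact: cphi|exact: cvg_cst].
  have := @norm_Rintegral_le _ a (a + e) e cd ltac:(lra).
  rewrite expr2 (_ : a + e - a = e); last by ring.
  apply => u /andP[u1 u2]; apply: (le_trans (pL _ _)).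
  by rewrite ger0_norm; lra.
have h1 := near_value s; have h2 := near_value 0; rewrite add0r in h2.
move: split1 split2 h1 h2.
set I1 := \int[lambda]_(u in `[0, s + e]) _.
set I2 := \int[lambda]_(u in `[0, s]) _.
set I3 := \int[lambda]_(u in `[s, s + e]) _.
set I4 := \int[lambda]_(u in `[0, e]) _.
set I5 := \int[lambda]_(u in `[e, s + e]) _ => E1 E2 h1 h2.
have -> : s^-1 * I5 - s^-1 * I2 - e * ((phi s - phi 0) / s) =
    s^-1 * ((I3 - e * phi s) - (I4 - e * phi 0)).
  have -> : I5 = I2 + I3 - I4 by lra.
  by field; rewrite gt_eqF.
rewrite normrM gtr0_norm ?invr_gt0// [2 / s]mulrC -mulrA ler_pM2l ?invr_gt0//.
by rewrite (le_trans (ler_normB _ _))//; lra.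
Qed.

End averaging.

Section smoothing.
Context {R : realType}.
Implicit Types (n : nat) (p : \bar R).

Definition avg_coord n s (i : 'I_n) (f : n.-tuple R -> R) x :=
  avg s (fun u => f (shift_coord x i u)).

Definition coord_lipschitz n (L : R) (f : n.-tuple R -> R) :=
  forall x j e, `|f (shift_coord x j e) - f x| <= L * `|e|.

(* A quantitative form of being C^{1,1} in the directions listed in [I]; it is
   stable under averaging because it is linear in (f, D). *)
Definition smooth_along n (I : pred 'I_n) (f : n.-tuple R -> R)
    (D : 'I_n -> n.-tuple R -> R) (L : R) :=
  0 <= L /\ forall i, I i -> coord_lipschitz L (D i) /\
    forall x e, 0 <= e ->
      `|f (shift_coord x i e) - f x - e * D i x| <= L * e ^+ 2.

Lemma coord_lipschitz_line n L (f : n.-tuple R -> R) x i : 0 <= L ->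
  coord_lipschitz L f -> continuous (fun u => f (shift_coord x i u)).
Proof.
move=> L0 fL u; apply/cvgrPdist_le => e e0.
have L1 : 0 < L + 1 by rewrite ltr_wpDl.
exists (e / (L + 1)); first by rewrite /= divr_gt0.
move=> v /= uv; rewrite distrC -{1}(subrK u v) [v - u + u]addrC -shift_coordD.
rewrite (le_trans (fL _ _ _))// distrC.
move: uv; rewrite ltr_pdivlMr// => uv; apply: ltW; apply: le_lt_trans uv.
by rewrite mulrC ler_wpM2l// lerDl.
Qed.

(** The distance is invariant under a common shift, so this is an average of functions Lipschitz for
    it. *)
Lemma avg_coord_lipschitz_p p n s i (f : n.-tuple R -> R) : 0 < s ->
  (0%E < p)%E -> lipschitz_p p f -> lipschitz_p p (avg_coord s i f).
Proof.
move=> s0 p0 fL x y; have fS := lipschitz_p_sep p0 fL.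
have cf z := lipschitz_continuous (sep_lipschitz_line z i fS).
rewrite /avg_coord -avgB//; apply: norm_avg_le => // u.
  by apply: cvgB; exact: cf.
move=> _ /=; apply: (le_trans (fL _ _)).
have E j : `|tnth (shift_coord x i u) j - tnth (shift_coord y i u) j| =
    `|tnth x j - tnth y j|.
  by rewrite !tnth_mktuple; case: ifP => _ //; congr `|_|; ring.
by rewrite /dist_p; case: (p) => [r||]; under eq_bigr do rewrite E.
Qed.

Lemma avg_coord_near n s i (f : n.-tuple R -> R) x : 0 < s ->
  sep_lipschitz f -> `|f x - avg_coord s i f x| <= s.
Proof.
move=> s0 fS; have cf z := lipschitz_continuous (sep_lipschitz_line z i fS).
rewrite -{1}(avg_cst (f x) s0) /avg_coord -avgB//; last by move=> ?; exact: cvg_cst.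
apply: norm_avg_le => // [u|u /andP[u0 us] /=].
  by apply: cvgB; [exact: cvg_cst|exact: cf].
by rewrite distrC (le_trans (fS _ _ _))// ger0_norm.
Qed.

Lemma avg_coord_coord_lipschitz n L s i (f : n.-tuple R -> R) : 0 < s -> 0 <= L ->
  coord_lipschitz L f -> coord_lipschitz L (avg_coord s i f).
Proof.
move=> s0 L0 fL x j e; have cf z := @coord_lipschitz_line n L f z i L0 fL.
rewrite /avg_coord -avgB//; apply: norm_avg_le => // u.
  by apply: cvgB; exact: cf.
by move=> _ /=; rewrite shift_coordC; exact: fL.
Qed.

(** Direction i becomes smooth by [avg_quadratic], its derivative being a difference quotient of
    step s, hence Lipschitz with constant 2 / s. The other directions stay smooth because averaging
    commutes with shifts. *)
Lemma smooth_along_avg n (I : pred 'I_n) s i (f : n.-tuple R -> R) D L : 0 < s ->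
  sep_lipschitz f -> smooth_along I f D L ->
  exists D' L', smooth_along (predU1 i I) (avg_coord s i f) D' L'.
Proof.
move=> s0 fS [L0 fD].
have s20 : 0 <= 2 / s by rewrite divr_ge0// ltW.
have cf z := lipschitz_continuous (sep_lipschitz_line z i fS).
pose D' j x := if j == i then (f (shift_coord x i s) - f x) / s
               else avg_coord s i (D j) x.
exists D', (L + 2 / s); split; first exact: addr_ge0.
move=> j; rewrite /= /D'; have [-> _|ji /= Ij] := eqVneq j i.
  split.
    move=> x k e; rewrite -mulrBl normrM (gtr0_norm (_ : 0 < s^-1)) ?invr_gt0//.
    apply: (@le_trans _ _ (2 / s * `|e|)); last by rewrite ler_wpM2r// lerDr.
    rewrite mulrAC ler_pM2r ?invr_gt0// shift_coordC.
    have h1 := fS (shift_coord x i s) k e; have h2 := fS x k e.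
    rewrite [X in `|X|](_ : _ =
        (f (shift_coord (shift_coord x i s) k e) - f (shift_coord x i s))
        - (f (shift_coord x k e) - f x)); last by ring.
    by rewrite (le_trans (ler_normB _ _))//; lra.
  move=> x e e0; rewrite /avg_coord.
  have -> : (fun u => f (shift_coord (shift_coord x i e) i u)) =
      (fun u => (fun v => f (shift_coord x i v)) (u + e)).
    by apply/funext => u; rewrite shift_coordD addrC.
  have := avg_quadratic s0 (sep_lipschitz_line x i fS) e0.
  rewrite shift_coord0 => /le_trans; apply.
  by rewrite ler_wpM2r ?sqr_ge0// lerDr.
have [Dj fDj] := fD j Ij.
split.
  move=> x k e; apply: (le_trans (avg_coord_coord_lipschitz i s0 L0 Dj x k e)).
  by rewrite ler_wpM2r// lerDl.
move=> x e e0; have cD z := @coord_lipschitz_line n L (D j) z i L0 Dj.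
rewrite /avg_coord -avgB// -avgZ// -avgB//; last 2 first.
- by move=> u; apply: cvgB; exact: cf.
- by move=> u; apply: cvgM; [exact: cvg_cst|exact: cD].
apply: (@le_trans _ _ (L * e ^+ 2)); last by rewrite ler_wpM2r ?sqr_ge0// lerDl.
apply: norm_avg_le => // [u|u _ /=].
  apply: cvgB; first by apply: cvgB; exact: cf.
  by apply: cvgM; [exact: cvg_cst|exact: cD].
by rewrite shift_coordC; exact: fDj.
Qed.

(** Averaging over the coordinates one after another makes each direction smooth in turn and moves
    the function by at most s each time. *)
Lemma lipschitz_p_smoothing p n (f : n.-tuple R -> R) (s : R) : 0 < s ->
  (0%E < p)%E -> lipschitz_p p f ->
  exists g D L, [/\ lipschitz_p p g, forall x, `|f x - g x| <= n%:R * s &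
    smooth_along predT g D L].
Proof.
move=> s0 p0 fL.
have : forall r : seq 'I_n, exists g D L, [/\ lipschitz_p p g,
    forall x, `|f x - g x| <= (size r)%:R * s & smooth_along (mem r) g D L].
  elim=> [|i r [g [D [L [gL fg gS]]]]].
    exists f, (fun _ _ => 0), 0; split => //.
    by move=> x; rewrite subrr normr0 mul0r.
  have [D' [L' gS']] := smooth_along_avg i s0 (lipschitz_p_sep p0 gL) gS.
  exists (avg_coord s i g), D', L'; split.
  - exact: avg_coord_lipschitz_p.
  - move=> x; rewrite -(subrK (g x) (f x)) -addrA.
    rewrite (le_trans (ler_normD _ _))//= -addn1 natrD mulrDl mul1r lerD//.
    by apply: avg_coord_near => //; exact: (lipschitz_p_sep p0 gL).
  - by case: gS' => L0 h; split => // j jr; exact: (h j jr).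
move=> /(_ (enum 'I_n)) [g [D [L [gL fg [L0 gS]]]]].
exists g, D, L; split => //; first by move=> x; have := fg x; rewrite size_enum_ord.
by split => // i _; apply: gS; rewrite /= mem_enum.
Qed.

(** For negative e, expand from the shifted point by the step -e. Moving the derivative back to x
    costs another L e^2, whence the factor 2. *)
Lemma smooth_along_two_sided n (f : n.-tuple R -> R) D L i x e :
  smooth_along predT f D L ->
  `|f (shift_coord x i e) - f x - e * D i x| <= 2 * L * e ^+ 2.
Proof.
move=> [L0 fD]; have [DL fDi] := fD i isT.
have [e0|/ltW e0] := leP 0 e.
  apply: (le_trans (fDi x e e0)).
  by rewrite ler_wpM2r ?sqr_ge0//; lra.
have ne0 : 0 <= - e by rewrite oppr_ge0.
have := fDi (shift_coord x i e) (- e) ne0.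
rewrite shift_coordD subrr shift_coord0 sqrrN => h1.
have := DL x i e; rewrite (ler0_norm e0).
set y := f _ in h1 *; set Dx := D i x; set Dy := D i _ in h1 * => h2.
have h3 : `|e * (Dy - Dx)| <= L * e ^+ 2.
  by rewrite normrM (ler0_norm e0) expr2; have := ler_wpM2l ne0 h2; lra.
move: h1 h3; rewrite !ler_norml => /andP[a1 a2] /andP[b1 b2].
apply/andP; split; lra.
Qed.

Lemma smooth_along_psup n (f : n.-tuple R -> R) D L i x :
  smooth_along predT f D L -> psup f i x = D i x.
Proof.
move=> fS; apply: limsup0_cvg; apply/cvgrPdist_le => eta eta0.
have [L0 _] := fS.
have L1 : 0 < 2 * L + 1 by rewrite ltr_wpDl// mulr_ge0.
exists (eta / (2 * L + 1)); first by rewrite /= divr_gt0.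
move=> e /=; rewrite sub0r normrN => ed e0.
have ep : 0 < `|e| by rewrite normr_gt0.
rewrite -(ler_pM2r ep) -normrM mulrBl divfK// distrC [D i x * e]mulrC.
apply: (le_trans (smooth_along_two_sided i x e fS)).
rewrite -(real_normK (num_real e)) expr2 mulrA ler_pM2r//.
move: ed; rewrite ltr_pdivlMr// => ed; nra.
Qed.

(** Partial expansions give a directional one by moving one coordinate at a time: the derivatives
    are Lipschitz, so evaluating them at the intermediate points instead of x costs only O(e^2). *)
Lemma smooth_along_path n (f : n.-tuple R -> R) D L (v : 'I_n -> R) (r : seq 'I_n) :
  smooth_along predT f D L -> exists K, forall x e,
  `|f (foldl (fun y i => shift_coord y i (e * v i)) x r) - f x
     - e * \sum_(i <- r) v i * D i x| <= K * e ^+ 2.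
Proof.
move=> fS; have [L0 fD] := fS; elim: r => [|i r [K IH]].
  by exists 0 => x e /=; rewrite big_nil mulr0 !subr0 subrr normr0 mul0r.
(* The three terms are the errors of the remaining path from x', of moving its derivatives from x'
   to x, and of the first step. *)
exists (K + L * `|v i| * (\sum_(j <- r) `|v j|) + 2 * L * v i ^+ 2) => x e /=.
set x' := shift_coord x i (e * v i); rewrite big_cons.
have h1 := IH x' e.
have h2 := smooth_along_two_sided i x (e * v i) fS.
have h3 : `|e * (\sum_(j <- r) v j * D j x' - \sum_(j <- r) v j * D j x)| <=
    L * `|v i| * (\sum_(j <- r) `|v j|) * e ^+ 2.
  have h : `|\sum_(j <- r) v j * D j x' - \sum_(j <- r) v j * D j x| <=
      (\sum_(j <- r) `|v j|) * (L * (`|e| * `|v i|)).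
    rewrite -sumrB mulr_suml (le_trans (ler_norm_sum _ _ _))//.
    apply: ler_sum => j _; rewrite -mulrBr normrM ler_wpM2l//.
    by have [Dj _] := fD j isT; rewrite (le_trans (Dj _ _ _))// normrM.
  rewrite normrM -(real_normK (num_real e)).
  apply: (le_trans (ler_wpM2l (normr_ge0 e) h)).
  by rewrite le_eqVlt; apply/orP; left; apply/eqP; ring.
move: h1 h2 h3; rewrite -/x'.
set S' := \sum_(j <- r) v j * D j x'; set S := \sum_(j <- r) v j * D j x.
set y := f (foldl _ _ _).
rewrite !ler_norml => /andP[a1 a2] /andP[b1 b2] /andP[c1 c2].
apply/andP; split; lra.
Qed.

Lemma foldl_shift_coord n (x : n.-tuple R) (w : 'I_n -> R) :
  foldl (fun y i => shift_coord y i (w i)) x (enum 'I_n) = add_coord x w.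
Proof.
have key : forall (r : seq 'I_n) y j, uniq r ->
    tnth (foldl (fun y i => shift_coord y i (w i)) y r) j =
    tnth y j + (if j \in r then w j else 0).
  elim=> [y j _|i r IH y j /= /andP[ir ur]]; first by rewrite addr0.
  rewrite IH// tnth_mktuple inE; case: eqVneq => [->|_]//=.
  by rewrite (negbTE ir) addr0.
apply: eq_from_tnth => j; rewrite key ?enum_uniq// mem_enum inE.
by rewrite tnth_mktuple.
Qed.

Lemma smooth_along_gradient p n (f : n.-tuple R -> R) D L x : (1 < p)%E ->
  lipschitz_p p f -> smooth_along predT f D L ->
  \sum_(i < n) `|psup f i x| `^ conj_exp p <= 1.
Proof.
move=> p1 fL fS; under eq_bigr do rewrite (smooth_along_psup _ _ fS).
apply: (lipschitz_p_gradient (x := x) p1 fL) => v eta eta0.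
have [K hK] := smooth_along_path v (enum 'I_n) fS.
have K1 : 0 < `|K| + 1 by rewrite ltr_wpDl.
(* This step size makes K e^2 at most eta e, also when K is 0 or negative. *)
exists (eta / (`|K| + 1)); first by rewrite divr_gt0.
set e := _ / _; have e0 : 0 < e by rewrite divr_gt0.
have := hK x e; rewrite foldl_shift_coord big_enum => /le_trans; apply.
rewrite expr2 mulrA ler_pM2r// /e mulrA ler_pdivrMr// mulrC ler_pM2l//.
by rewrite (le_trans (ler_norm _))// lerDl.
Qed.

End smoothing.

(** * Bounds on the variance *)

Section variance_bounds.
Context {R : realType} (mu : probability R R).
Notation P := (power_probability mu).
Variables (c alpha k : R) (p : \bar R).
Hypotheses (c0 : 0 <= c) (a01 : 0 < alpha <= 1) (k0 : 0 < k).
Hypotheses (p1 : (1 < p)%E) (kq : k <= conj_exp p).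
Hypothesis gradient_ineq : forall h : R -> R, Lip1 h -> exists m,
  (\int[mu]_x ((h x - m) ^+ 2)%:E <=
     c%:E * (\int[mu]_x (abs_grad h x) `^ k) `^ alpha)%E.

Let theta := alpha * k * conj_inv p.

Let p0 : (0%E < p)%E. Proof. by apply: lt_trans p1; rewrite lte_fin. Qed.

Let thetaE : theta = alpha * k / conj_exp p.
Proof.
rewrite /theta; congr (_ * _).
by rewrite /conj_inv /conj_exp; case: (p) => [r| |]; rewrite ?invr1 ?invf_div.
Qed.

Let theta_ge0 : 0 <= theta.
Proof.
have /andP[a0 _] := a01.
by rewrite thetaE divr_ge0 ?mulr_ge0 ?(ltW a0) ?(ltW k0)// (le_trans (ltW k0) kq).
Qed.

Lemma sum_partialsE n (f : n.-tuple R -> R) : lipschitz_p p f ->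
  (sum_partials mu p f =
   \sum_(i < n) \int[P n]_x (`|psup f i x| `^ conj_exp p)%:E)%E.
Proof.
move=> fL; apply: eq_bigr => i _; apply: eq_integral => x _.
by rewrite partial_supE//; exact: (lipschitz_p_sep p0 fL).
Qed.

Lemma sum_partials_le1 n (f : n.-tuple R -> R) : lipschitz_p p f ->
  {ae P n, forall x, \sum_(i < n) `|psup f i x| `^ conj_exp p <= 1} ->
  (0 <= sum_partials mu p f <= 1)%E.
Proof.
move=> fL fD; have fS := lipschitz_p_sep p0 fL.
rewrite sum_partialsE// sume_ge0/=; last first.
  by move=> i _; apply: integral_ge0 => x _; rewrite lee_fin powR_ge0.
have mf i := measurable_norm_psup_powR i (conj_exp p) fS.
rewrite -ge0_integral_sum//.
apply: (@le_trans _ _ (\int[P n]_x 1)%E); last first.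
  by rewrite integral_cst//= probability_setT mule1.
apply: ae_ge0_le_integral => //.
- by move=> x _; apply: sume_ge0 => i _; rewrite lee_fin powR_ge0.
- exact: emeasurable_sum.
- by apply: ae_imply fD => x fx _; rewrite sumEFin lee_fin.
Qed.

Lemma variance_le_sum_partials n (f : n.-tuple R -> R) : (0 < n)%N ->
  lipschitz_p p f ->
  ('V_(P n)[f] <= c%:E * (n%:R `^ (1 - theta))%:E * (sum_partials mu p f) `^ theta)%E.
Proof.
move=> n0 fL; rewrite sum_partialsE// thetaE.
by apply: variance_le_sum_psup => //; exact: (lipschitz_p_sep p0 fL).
Qed.

Lemma bound_le_of_gradient n (f : n.-tuple R -> R) : lipschitz_p p f ->
  {ae P n, forall x, \sum_(i < n) `|psup f i x| `^ conj_exp p <= 1} ->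
  (c%:E * (n%:R `^ (1 - theta))%:E * (sum_partials mu p f) `^ theta <=
   (c * n%:R `^ (1 - theta))%:E)%E.
Proof.
move=> fL fD; have /andP[s0 s1] := sum_partials_le1 fL fD.
rewrite -EFinM -[leRHS]mule1 lee_wpmul2l ?lee_fin ?mulr_ge0 ?powR_ge0//.
rewrite [leRHS](_ : 1%E = (1%E : \bar R) `^ theta)%E; last by rewrite poweR_EFin
    powR1.
exact: (le_poweR theta_ge0).
Qed.

Lemma bound_le_of_differentiable n (f : n.-tuple R -> R) : lipschitz_p p f ->
  {ae P n, forall x, differentiable_tuple f x} ->
  (c%:E * (n%:R `^ (1 - theta))%:E * (sum_partials mu p f) `^ theta <=
   (c * n%:R `^ (1 - theta))%:E)%E.
Proof.
move=> fL fD; apply: bound_le_of_gradient => //.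
by apply: ae_imply fD => x; exact: differentiable_tuple_gradient.
Qed.

(* A smoothing of f is differentiable everywhere, is Lipschitz for the same
   distance, and has almost the same variance. *)
Lemma variance_le_uniform n (f : n.-tuple R -> R) : (0 < n)%N -> lipschitz_p p f ->
  ('V_(P n)[f] <= (c * n%:R `^ (1 - theta))%:E)%E.
Proof.
move=> n0 fL; have /andP[a0 _] := a01.
have mu2 := id_sq_integral_lty c0 a0 k0 gradient_ineq.
have L2 (g : n.-tuple R -> R) : lipschitz_p p g -> sq_integrable (P n) g.
  move=> gL; apply: sep_lipschitz_sq_integrable => //.
  exact: (lipschitz_p_sep p0 gL).
apply: variance_lsc; first exact: L2.
move=> e e0; have nR : 0 < n%:R :> R by rewrite ltr0n.
have [g [D [L [gL fg gS]]]] := lipschitz_p_smoothing (divr_gt0 e0 nR) p0 fL.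
exists g; split; first exact: L2.
  by move=> x; have := fg x; rewrite mulrC divfK ?gt_eqF.
apply: (le_trans (variance_le_sum_partials n0 gL)).
apply: bound_le_of_gradient => //.
by apply: aeW => x; exact: smooth_along_gradient gS.
Qed.

End variance_bounds.

Section conjugate_exponents.
Context {R : realType}.

Lemma conj_exp_ge1 (p : \bar R) : (1 < p)%E -> 1 <= conj_exp p.
Proof.
case: p => [r| |]//=; rewrite lte_fin => r1.
by rewrite ler_pdivlMr ?subr_gt0// mul1r; lra.
Qed.

(** Here p <= 2 enters: it gives k <= q for k = 2 in part (ii). *)
Lemma conj_exp_ge2 (p : \bar R) : (1 < p <= 2%:E)%E -> 2 <= conj_exp p.
Proof.
case: p => [r| |] /andP[]//=; rewrite lte_fin lee_fin => r1 r2.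
by rewrite ler_pdivlMr ?subr_gt0//; lra.
Qed.

End conjugate_exponents.

Unset Implicit Arguments.
Set Strict Implicit.
Local Close Scope classical_set_scope.
Local Open Scope ring_scope.
Local Open Scope ereal_scope.

Theorem theorem1p7 (R : realType) (mu : probability R R) :
  (forall (alpha : R) (p : \bar R),
    (0 < alpha < 1)%R -> 1 < p -> C1 mu alpha 2 < +oo ->
    (forall (n : nat) (f : n.-tuple R -> R), (0 < n)%N -> lipschitz_p p f ->
      'V_(power_probability mu n)[f] <=
        C1 mu alpha 2 * (n%:R `^ (1 - alpha * conj_inv p))%:E *
        (sum_partials mu p f) `^ (alpha * conj_inv p)) /\
    (exists K : R,
      forall (n : nat) (f : n.-tuple R -> R), (0 < n)%N -> lipschitz_p p f ->
        'V_(power_probability mu n)[f] <=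
          (K * n%:R `^ (1 - alpha * conj_inv p))%:E /\
        ({ae power_probability mu n, forall x, differentiable_tuple f x} ->
          C1 mu alpha 2 * (n%:R `^ (1 - alpha * conj_inv p))%:E *
          (sum_partials mu p f) `^ (alpha * conj_inv p) <=
          (K * n%:R `^ (1 - alpha * conj_inv p))%:E)))
  /\
  (forall (alpha : R) (p : \bar R),
    (0 < alpha < 1)%R -> 1 < p <= 2%:E -> C2 mu alpha < +oo ->
    (forall (n : nat) (f : n.-tuple R -> R), (0 < n)%N -> lipschitz_p p f ->
      'V_(power_probability mu n)[f] <=
        C2 mu alpha * (n%:R `^ (1 - 2 * alpha * conj_inv p))%:E *
        (sum_partials mu p f) `^ (2 * alpha * conj_inv p)) /\
    (exists K : R,
      forall (n : nat) (f : n.-tuple R -> R), (0 < n)%N -> lipschitz_p p f ->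
        'V_(power_probability mu n)[f] <=
          (K * n%:R `^ (1 - 2 * alpha * conj_inv p))%:E /\
        ({ae power_probability mu n, forall x, differentiable_tuple f x} ->
          C2 mu alpha * (n%:R `^ (1 - 2 * alpha * conj_inv p))%:E *
          (sum_partials mu p f) `^ (2 * alpha * conj_inv p) <=
          (K * n%:R `^ (1 - 2 * alpha * conj_inv p))%:E))).
Proof.
split=> alpha p /andP[a0 a1].
- move=> p1 Coo.
  have a01 : (0 < alpha <= 1)%R by rewrite a0 ltW.
  have c0 : (0 <= fine (C1 mu alpha 2))%R by rewrite fine_ge0// C1_ge0.
  have CE : C1 mu alpha 2 = (fine (C1 mu alpha 2))%:E.
    by rewrite fineK// ge0_fin_numE// C1_ge0.
  have grad := C1_gradient_ineq a0 Coo.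
  have q1 := conj_exp_ge1 p1.
  have := variance_le_sum_partials c0 a01 ltr01 p1 q1 grad.
  have := bound_le_of_differentiable c0 a01 ltr01 p1 q1.
  have := variance_le_uniform c0 a01 ltr01 p1 q1 grad.
  (* With k = 1 the common exponent is [alpha * conj_inv p], and the uniform constant K is the value
     of the functional itself. *)
  rewrite mulr1 -CE => h1 h2 h3; split; first exact: h3.
  by exists (fine (C1 mu alpha 2)) => n f n0 fL; split; [exact: h1|exact: h2].
- move=> p2 Coo; have /andP[p1 _] := p2.
  have a01 : (0 < alpha <= 1)%R by rewrite a0 ltW.
  have c0 : (0 <= fine (C2 mu alpha))%R by rewrite fine_ge0// C2_ge0.
  have CE : C2 mu alpha = (fine (C2 mu alpha))%:E.
    by rewrite fineK// ge0_fin_numE// C2_ge0.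
  have grad := C2_gradient_ineq a0 Coo.
  have q1 := conj_exp_ge2 p2.
  have := variance_le_sum_partials c0 a01 (ltr0Sn _ 1) p1 q1 grad.
  have := bound_le_of_differentiable c0 a01 (ltr0Sn _ 1) p1 q1.
  have := variance_le_uniform c0 a01 (ltr0Sn _ 1) p1 q1 grad.
  rewrite [(alpha * 2)%R]mulrC -CE => h1 h2 h3; split; first exact: h3.
  by exists (fine (C2 mu alpha)) => n f n0 fL; split; [exact: h1|exact: h2].
Qed.
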